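(* Under information regulation, the Simulated-Myerson Auction, under the information sufficiency, regular value and regular virtual value conditions, is dominant-strategy IIC and IR, and it achieves maximum revenue.
   Context: Setting. A single item is auctioned to $n$ bidders. Bidder $i$ has a (possibly infinite) type set $T_i$, a finite state set $\Theta_i$ and a value function $v_i:T_i\times\Theta_i\to\mathbb{R}$. Write $T=\prod_i T_i$, $\Theta=\prod_i\Theta_i$, and $\Delta(X)$ for the probability distributions on $X$. The state profile $\boldsymbol\theta$ is drawn from a publicly known prior $g\in\Delta(\Theta)$ with marginals $g_i$ (states may be correlated). Types $t_i\sim h_i$ (with $h_i$ publicly known) are independent across bidders and independent of the information variables. An experiment of bidder $i$ is $\tau_i\in\Delta(\Delta(\Theta_i))$ with mean $g_i$; its outcome $\sigma_i\in\Delta(\Theta_i)$ is the posterior belief on $\theta_i$, i.e. $\Pr(\theta_i\mid\sigma_i)=\sigma_i(\theta_i)$. Write $\tau_i\geq_{\mathrm{MPS}}\lambda_i$ if $\sigma_i\sim\tau_i$ and $s_i\sim\lambda_i$ can be coupled so that $\mathbf{E}[\sigma_i\mid s_i]=s_i$. Bidder $i$ privately observes $t_i$ and the information variable $\sigma_i\sim\tau_i$ (not necessarily $\theta_i$). Standing assumption: $\theta_i\perp\sigma_j\mid\sigma_i$ for all $i,j$, so that once $\sigma_i$ is known the other bidders' signals do not change the belief about $\theta_i$. Bidder $i$ acts by reporting $b_i\in T_i$ and committing to an experiment $\lambda_i$ with $\tau_i\geq_{\mathrm{MPS}}\lambda_i$ ($\lambda_i=\tau_i$ is full revelation); the auctioneer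 sees $\boldsymbol b$ and $\boldsymbol s=(s_1,\dots,s_n)$, $s_i\sim\lambda_i$. Inference (without regulation). Given $\boldsymbol\theta$, signals are sampled independently across bidders, so $\boldsymbol s$ has joint distribution $\boldsymbol\lambda(\boldsymbol s)=\sum_{\boldsymbol\theta}g(\boldsymbol\theta)\prod_i s_i(\theta_i)\lambda_i(s_i)/g_i(\theta_i)$ and the posterior is $\Pr(\boldsymbol\theta\mid\boldsymbol s)\propto g(\boldsymbol\theta)\prod_i s_i(\theta_i)/g_i(\theta_i)$; $\boldsymbol s$ is identified with this posterior in $\Delta(\Theta)$. Let $v_i(b_i;\boldsymbol s)=\sum_{\boldsymbol\theta}\Pr(\boldsymbol\theta\mid\boldsymbol s)v_i(b_i;\theta_i)$ and $v_i(b_i;s_i)=\sum_{\theta_i}s_i(\theta_i)v_i(b_i;\theta_i)$. $\boldsymbol\tau$ denotes the joint distribution of $\boldsymbol\sigma$ under full revelation. Information regulation. When committing to the mechanism, the auctioneer commits to estimate each bidder $i$'s state with only his own signal $s_i\in\Delta(\Theta_i)$: given a signal profile $(s_i,s_{-i})$, the auctioneer's belief of each bidder $i$'s state is $\Pr(\theta_i\mid s_i)$. Mechanisms. A mechanism is $(x,p)$ with $x,p:T\times\Delta(\Theta)\to\mathbb{R}^n_{+}$ (allocation and payment), $\sum_i x_i\le1$. With true type $t_i$, $\mathtt U_i(\boldsymbol b;\boldsymbol s)=x_i(\boldsymbol b;\boldsymbol s)v_i(t_i;\boldsymbol s)-p_i(\boldsymbol b;\boldsymbol s)$ and $\bar{\mathtt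 U}_i(\boldsymbol b;\boldsymbol\lambda)=\sum_{\boldsymbol s}\boldsymbol\lambda(\boldsymbol s)\,\mathtt U_i(\boldsymbol b;\boldsymbol s)$. Ex-post IIC (incentive and information compatible): for every bidder $i$ with any types $b_i,t_i\in T_i$ and experiments $\tau_i\geq_{\mathrm{MPS}}\lambda_i$, given the others' truthful reports $t_{-i}$ and fully revealing experiments $\tau_{-i}$, $\bar{\mathtt U}_i(t_i,t_{-i};\tau_i,\tau_{-i})\ge\bar{\mathtt U}_i(b_i,t_{-i};\lambda_i,\tau_{-i})$. Dominant-strategy IIC: for every bidder $i$ with any types $b_i,t_i\in T_i$ and experiments $\tau_i\geq_{\mathrm{MPS}}\lambda_i$, given any possibly untruthful reports $b_{-i}$ and possibly partially revealing experiments $\lambda_{-i}$ of the others (i.e. $\tau_j\geq_{\mathrm{MPS}}\lambda_j$ for $j\ne i$), $\bar{\mathtt U}_i(t_i,b_{-i};\tau_i,\lambda_{-i})\ge\bar{\mathtt U}_i(b_i,b_{-i};\lambda_i,\lambda_{-i})$. IR (ex-post): $\mathtt U_i(t_i,t_{-i};\sigma_i,\sigma_{-i})\ge0$ for every $i$, every fully revealing signal profile and every truthful type profile. Under information regulation bidder $i$'s value is a function of his own signal only, and his expected utility in the dominant-strategy IIC condition, with true type $t_i$, is $\mathbf{E}_{s_{-i}\sim\lambda_{-i}}\mathbf{E}_{s_i\sim\lambda_i}\big[x_i(\boldsymbol b;s_i,s_{-i})\,v_i(t_i;s_i)-p_i(\boldsymbol b;s_i,s_{-i})\big]$. Revenue.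 The revenue of a mechanism under truthful behavior is $\mathbf{E}_{\boldsymbol\sigma\sim\boldsymbol\tau}\mathbf{E}_{\boldsymbol t\sim h}\big[\sum_{i=1}^n p_i(\boldsymbol t;\boldsymbol\sigma)\big]$; maximum revenue is its maximum over all ex-post IIC and ex-post IR mechanisms. Virtual values. For each $\theta_i$, let $F_i^{\theta}$ be the distribution function of $v_i(t_i;\theta_i)$, $t_i\sim h_i$, with density $f_i^{\theta}$; $\phi_i(t_i;\theta_i)=v_i(t_i;\theta_i)-\frac{1-F_i^{\theta}(v_i(t_i;\theta_i))}{f_i^{\theta}(v_i(t_i;\theta_i))}$, with inverse $\phi_i^{-1}(\cdot;\theta_i)$ in $t_i$. Simulated-Myerson Auction. The base mechanism is Myerson's optimal auction: for each $\boldsymbol\theta$, $x_i(\boldsymbol b;\boldsymbol\theta)=1$ if $i=\arg\max_{j}\{\phi_j(b_j;\theta_j):\phi_j(b_j;\theta_j)>0\}$ and $0$ otherwise; $p_i(\boldsymbol b;\boldsymbol\theta)=v_i(b_i^*;\theta_i)$ with $b_i^*=\phi_i^{-1}\big(\max\{0,\max_{j\ne i}\phi_j(b_j;\theta_j)\};\theta_i\big)$ if $i$ is that winner, and $0$ otherwise. The auction outputs $x_i(\boldsymbol b;\boldsymbol s)=\sum_{\boldsymbol\theta\in\Theta}\Pr(\boldsymbol\theta\mid\boldsymbol s)\,x_i(\boldsymbol b;\boldsymbol\theta)$ and $p_i(\boldsymbol b;\boldsymbol s)=\sum_{\boldsymbol\theta\in\Theta}\Pr(\boldsymbol\theta\mid\boldsymbol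 s)\,p_i(\boldsymbol b;\boldsymbol\theta)$, where $\Pr(\boldsymbol\theta\mid\boldsymbol s)$ is the auctioneer's belief about the state profile (subject to the commitment above when information regulation is in force). Conditions. Information sufficiency: for any bidder $i$, with information variable $\sigma_i$, and for any fixed value profile $v_{-i}$ of the others and type $t_i$, $\mathbf{Var}_{\theta_i\sim\sigma_i}\big[x_i\big(v_i(t_i;\theta_i),v_{-i}\big)\big]=0$, where $x_i(v_i,v_{-i})$ is the allocation of the base mechanism (Myerson's optimal auction) as a function of the value profile, its dependence on the value distributions being suppressed from the notation. Regular values: for any bidder $i$ there exists a total ordering of the states such that, for any $\theta_i,\theta_i'\in\Theta_i$, $v_i(t_i;\theta_i)\ge v_i(t_i;\theta_i')\iff v_i(t_i';\theta_i)\ge v_i(t_i';\theta_i')$ for all $t_i,t_i'\in T_i$. Regular virtual value: for any $i$, $v_i(t_i;\theta_i)\ge v_i(t_i';\theta_i')\iff\phi_i(t_i;\theta_i)\ge\phi_i(t_i';\theta_i')$ for all $t_i,t_i'\in T_i$, $\theta_i,\theta_i'\in\Theta_i$.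
   Formalization: Added, since the claim fails without them: values v_i(t_i;θ_i) have finite mean; the density f_i^θ is positive throughout the interval of values (no gaps); and types are ordered the same way by value in every state (one-dimensional types). *)

(* Defs.v *)
From HB Require Import structures.
From mathcomp Require Import all_boot all_order all_algebra.
From mathcomp Require Import all_classical all_reals all_analysis.

Set Implicit Arguments.
Unset Strict Implicit.
Unset Printing Implicit Defensive.

Import Order.TTheory GRing.Theory Num.Theory.
Import numFieldNormedType.Exports.

Local Open Scope classical_set_scope.
Local Open Scope ring_scope.

(* Nonempty finite sets; the point is only used because a measurableType must
   be inhabited. *)
#[short(type="finPointedType")]
HB.structure Definition FinPointed := {A of Finite A & Pointed A}.

(** * Probability distributions on a finite set, and their Borel sets *)

Record dist (R : realType) (A : finType) := Dist {
  mass :> A -> R;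
  mass_ge0 : forall a, 0 <= mass a;
  mass_sum1 : \sum_a mass a = 1 }.

HB.instance Definition _ (R : realType) (A : finType) :=
  gen_eqMixin (dist R A).
HB.instance Definition _ (R : realType) (A : finType) :=
  gen_choiceMixin (dist R A).

Lemma dirac_ge0 (R : realType) (A : finPointedType) (a : A) :
  0 <= (a == point)%:R :> R.
Proof. exact: ler0n. Qed.

Lemma dirac_sum1 (R : realType) (A : finPointedType) :
  \sum_(a : A) (a == point)%:R = 1 :> R.
Proof.
rewrite (bigD1 (point : A)) //= eqxx big1 ?addr0 // => a /negbTE ->.
by [].
Qed.

HB.instance Definition _ (R : realType) (A : finPointedType) :=
  isPointed.Build (dist R A) (Dist (@dirac_ge0 R A) (dirac_sum1 R A)).

(* On the simplex the Borel sigma-algebra is generated by the coordinates. *)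
Definition coordinate_sets (R : realType) (A : finType) : set (set (dist R A)) :=
  [set C | exists a : A, exists2 B : set R,
             measurable B & C = [set s : dist R A | B (s a)]].

Definition belief_display : measure_display. Proof. exact. Qed.

HB.instance Definition _ (R : realType) (A : finPointedType) :=
  @isMeasurable.Build belief_display (dist R A) <<s @coordinate_sets R A >>
    (@sigma_algebra0 _ setT _) (@sigma_algebraC _ _)
    (@sigma_algebra_bigcup _ setT _).

Definition mean (R : realType) (A : finType) (p : dist R A) (f : A -> R) : R :=
  \sum_a p a * f a.

Definition variance (R : realType) (A : finType) (p : dist R A) (f : A -> R) : R :=
  mean p (fun a => (f a - mean p f) ^+ 2).

(** * Profiles, with the product sigma-algebra *)

Definition cylinders d n (X : 'I_n -> measurableType d) :
    set (set (forall i, X i)) :=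
  [set C | exists i : 'I_n, exists2 B : set (X i),
             measurable B & C = [set x : forall i, X i | B (x i)]].

Definition profile d n (X : 'I_n -> measurableType d) : Type := forall i, X i.

Definition profile_display : measure_display -> measure_display. Proof. exact. Qed.

HB.instance Definition _ d n (X : 'I_n -> measurableType d) :=
  Pointed.on (profile X).
HB.instance Definition _ d n (X : 'I_n -> measurableType d) :=
  @isMeasurable.Build (profile_display d) (profile X) <<s @cylinders d n X >>
    (@sigma_algebra0 _ setT _) (@sigma_algebraC _ _)
    (@sigma_algebra_bigcup _ setT _).

(* [H] is the law of a profile of independent components with laws [h i]. *)
Definition product_law (R : realType) d n (X : 'I_n -> measurableType d)
    (h : forall i, probability (X i) R) (H : probability (profile X) R) : Prop :=
  forall B : forall i, set (X i), (forall i, measurable (B i)) ->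
    H [set x : profile X | forall i, B i (x i)] =
      (\prod_(i < n) fine (h i (B i)))%:E.

(** * Signals and experiments *)

Section Signals.
Context {R : realType}.

(* Topological support: every neighbourhood of the belief is charged. *)
Definition belief_support (A : finPointedType) (mu : probability (dist R A) R) :
    set (dist R A) :=
  [set s | forall e : R, 0 < e ->
     (0 < mu [set s' : dist R A | forall a, `|s' a - s a| < e]%R)%E].

(* tau >=_MPS lam: Q is a coupling of sigma ~ tau and s ~ lam such that
   E[sigma | s] = s. *)
Definition mps (A : finPointedType) (tau lam : probability (dist R A) R) : Prop :=
  exists Q : probability (dist R A * dist R A)%type R,
    [/\ forall B, measurable B -> Q (B `*` setT) = tau B,
        forall B, measurable B -> Q (setT `*` B) = lam B &
        forall (B : set (dist R A)) (a : A), measurable B ->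
          \int[Q]_(z in setT `*` B) (z.1 a : R) =
          \int[Q]_(z in setT `*` B) (z.2 a : R)].

Context {n : nat} (Th : 'I_n -> finPointedType).

Definition signal (i : 'I_n) : measurableType belief_display := dist R (Th i).

Variable g : dist R {dffun forall i, Th i}.

Definition marginal (i : 'I_n) (a : Th i) : R :=
  \sum_(th : {dffun forall i, Th i} | th i == a) g th.

Definition is_experiment (i : 'I_n) (tau : probability (signal i) R) : Prop :=
  forall a : Th i, \int[tau]_s (s a : R) = marginal a.

(* The law of the signal profile s,
     sum_th g(th) prod_i s_i(th_i) lam_i(ds_i) / g_i(th_i),
   characterised by its values on measurable rectangles. *)
Definition joint_law (lam : forall i, probability (signal i) R)
    (L : probability (profile signal) R) : Prop :=
  forall B : forall i, set (signal i), (forall i, measurable (B i)) ->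
    L [set s : profile signal | forall i, B i (s i)] =
      (\sum_(th : {dffun forall i, Th i})
         g th * \prod_(i < n) \int[lam i]_(s in B i) (s (th i) / marginal (th i) : R))%:E.

Definition likelihood (s : profile signal) (th : {dffun forall i, Th i}) : R :=
  g th * \prod_(i < n) (s i (th i) / marginal (th i)).

(* Pr(th | s) without regulation. *)
Definition posterior (s : profile signal) (th : {dffun forall i, Th i}) : R :=
  likelihood s th / \sum_(th' : {dffun forall i, Th i}) likelihood s th'.

(* Pr(th | s) under information regulation: the state of each bidder is
   estimated from his own signal only, so the belief on the profile is the
   product of the s_i. *)
Definition regulated_belief (s : profile signal)
    (th : {dffun forall i, Th i}) : R :=
  \prod_(i < n) s i (th i).

(* theta_i is independent of the other signals given sigma_i: almost surely the
   posterior of theta_i given the whole profile sigma is sigma_i. *)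
Definition own_signal_sufficient (L : probability (profile signal) R) : Prop :=
  {ae L, forall s : profile signal, forall (i : 'I_n) (a : Th i),
     \sum_(th : {dffun forall i, Th i} | th i == a) posterior s th = s i a}.

End Signals.

(** * The auction environment *)

Section Auction.
Context {R : realType} {n : nat} {d : measure_display}.
Context {T : 'I_n -> measurableType d} {h : forall i, probability (T i) R}.
Context {Th : 'I_n -> finPointedType}.

Local Notation S := (@signal R n Th).
Local Notation states := {dffun forall i, Th i}.

(* [v i a t] is v_i(t; a). *)
Variable v : forall i, Th i -> {RV (h i) >-> R}.
Arguments v : clear implicits.
(* [f i a] is the density f_i^a of v_i(t_i; a). *)
Variable f : forall i, Th i -> R -> R.
Arguments f : clear implicits.

Definition value_density : Prop :=
  forall i (a : Th i),
    [/\ measurable_fun setT (f i a), forall r, 0 <= f i a r &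
        forall B : set R, measurable B ->
          distribution (h i) (v i a) B =
            (\int[lebesgue_measure]_(r in B) (f i a r)%:E)%E].

(* Myerson's single-parameter environment.  The formula for phi and its inverse
   in t_i presuppose that values have a finite mean, that the density is positive
   throughout the interval of values, and that types are one-dimensional: larger
   types have (weakly) larger values in every state.  The latter cannot be
   dropped: with one bidder and two equally likely states L, H revealed by tau,
   t uniform on [0, 1], v(t; L) = t and v(t; H) = 7/2 - t are regular, but the
   auctioneer can extract the full surplus. *)
Definition finite_mean_values : Prop :=
  forall i (a : Th i), (h i).-integrable setT (EFin \o v i a).

Definition positive_density : Prop :=
  forall i (a : Th i) (t t' : T i) (r : R),
    v i a t < r < v i a t' -> 0 < f i a r.

Definition ordered_types : Prop :=
  forall i (a a' : Th i) (t t' : T i), v i a t < v i a t' -> v i a' t <= v i a' t'.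

Definition value_cdf i (a : Th i) (r : R) : R := fine (cdf (v i a) r).

(* The virtual value of a bidder i with value r in state a. *)
Definition virtual i (a : Th i) (r : R) : R :=
  r - (1 - value_cdf a r) / f i a r.

Definition phi i (a : Th i) (t : T i) : R := virtual a (v i a t).

(** ** Myerson's auction *)

(* Allocation as a function of the value profile w, the value of bidder j being
   distributed according to his distribution in state th j.  Ties between
   maximal virtual values are broken in favour of the smallest index. *)
Definition myerson_alloc (th : forall j, Th j) (w : 'I_n -> R) (i : 'I_n) : R :=
  ((0 < virtual (th i) (w i)) &&
   [forall j : 'I_n, (j != i) ==>
      if (i < j)%N then virtual (th j) (w j) <= virtual (th i) (w i)
      else virtual (th j) (w j) < virtual (th i) (w i)])%:R.

Definition base_alloc (b : profile T) (th : forall j, Th j) (i : 'I_n) : R :=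
  myerson_alloc th (fun j => v j (th j) (b j)) i.

(* v_i(phi_i^{-1}(z; a); a), with the generalised inverse
   phi_i^{-1}(z; a) = inf {t | z <= phi_i(t; a)}. *)
Definition critical_value i (a : Th i) (z : R) : R :=
  inf [set v i a t | t in [set t : T i | z <= phi a t]].

Definition base_pay (b : profile T) (th : forall j, Th j) (i : 'I_n) : R :=
  base_alloc b th i *
  critical_value (th i) (\big[Num.max/0]_(j < n | j != i) phi (th j) (b j)).

(** ** Mechanisms *)

(* Mechanisms may depend on the whole signal profile, and not only on the
   posterior in Delta(Theta) that it induces. *)
Record mechanism := Mechanism {
  alloc : 'I_n -> profile T -> profile S -> R;
  pay : 'I_n -> profile T -> profile S -> R }.

Definition is_mechanism (M : mechanism) : Prop :=
  [/\ forall i b s, 0 <= alloc M i b s,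
      forall i b s, 0 <= pay M i b s,
      forall b s, \sum_(i < n) alloc M i b s <= 1,
      forall i, measurable_fun setT
        (fun bs : profile T * profile S => alloc M i bs.1 bs.2) &
      forall i, measurable_fun setT
        (fun bs : profile T * profile S => pay M i bs.1 bs.2)].

(* The Simulated-Myerson Auction for a belief Pr(th | s) of the auctioneer. *)
Definition simulated_myerson (Pr : profile S -> states -> R) : mechanism :=
  {| alloc := fun i b s => \sum_(th : states) Pr s th * base_alloc b th i;
     pay := fun i b s => \sum_(th : states) Pr s th * base_pay b th i |}.

(* v_i(t_i; s) for the belief Pr, and v_i(t_i; s_i). *)
Definition interim_value (Pr : profile S -> states -> R)
    i (t : T i) (s : profile S) : R :=
  \sum_(th : states) Pr s th * v i (th i) t.

Definition own_value i (t : T i) (s : profile S) : R := mean (s i) (v i ^~ t).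

Definition utility (V : forall i, T i -> profile S -> R) (M : mechanism)
    i (t : T i) (b : profile T) (s : profile S) : R :=
  alloc M i b s * V i t s - pay M i b s.

Definition upd_type (b : profile T) i (t : T i) : profile T :=
  dfwith (b : forall j, T j) i t.
Definition upd_signal (s : profile S) i (r : S i) : profile S :=
  dfwith (s : forall j, S j) i r.

Variable g : dist R states.
Variable tau : forall i, probability (S i) R.
Arguments tau : clear implicits.
(* The law of sigma under full revelation. *)
Variable Tau : probability (profile S) R.

Definition ex_post_IIC (V : forall i, T i -> profile S -> R) (M : mechanism) :
    Prop :=
  forall (i : 'I_n) (t : profile T) (bi : T i) (lam : probability (S i) R)
         (L : probability (profile S) R),
    mps (tau i) lam ->
    joint_law g (dfwith tau i lam) L ->
    (\int[L]_s (utility V M (t i) (upd_type t bi) s)%:E <=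
     \int[Tau]_s (utility V M (t i) t s)%:E)%E.

Definition ex_post_IR (V : forall i, T i -> profile S -> R) (M : mechanism) :
    Prop :=
  forall (i : 'I_n) (t : profile T) (s : profile S),
    (forall j, belief_support (tau j) (s j)) -> 0 <= utility V M (t i) t s.

(* Under information regulation, the expected utility is
   E_{s_{-i} ~ lam_{-i}} E_{s_i ~ mu} [x_i v_i(t_i; s_i) - p_i].  The outer
   integral is over a whole profile s, whose component s_i is then discarded:
   under L the law of s_{-i} only depends on lam_{-i}. *)
Definition regulated_utility (M : mechanism) i (t : T i) (b : profile T)
    (mu : probability (S i) R) (L : probability (profile S) R) : \bar R :=
  (\int[L]_s \int[mu]_r (utility own_value M t b (upd_signal s r))%:E)%E.

Definition regulated_dominant_strategy_IIC (M : mechanism) : Prop :=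
  forall (i : 'I_n) (t : T i) (b : profile T)
         (lam : forall j, probability (S j) R) (L : probability (profile S) R),
    (forall j, mps (tau j) (lam j)) ->
    joint_law g lam L ->
    (regulated_utility M t b (lam i) L <=
     regulated_utility M t (upd_type b t) (tau i) L)%E.

Variable H : probability (profile T) R.

Definition revenue (M : mechanism) : \bar R :=
  (\int[Tau]_s \int[H]_t (\sum_(i < n) pay M i t s)%:E)%E.

(* The revenue of M is at least that of all the mechanisms that are ex-post IIC
   and ex-post IR when the value of bidder i with type t_i is V i t_i s. *)
Definition max_revenue_for (V : forall i, T i -> profile S -> R)
    (M : mechanism) : Prop :=
  forall M', is_mechanism M' -> ex_post_IIC V M' -> ex_post_IR V M' ->
    (revenue M' <= revenue M)%E.

(** ** Conditions *)

(* The fixed value profile of the others is v_j(t_j; th_j), j != i. *)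
Definition information_sufficiency : Prop :=
  forall (i : 'I_n) (s : S i), belief_support (tau i) s ->
  forall (t : profile T) (th : forall j, Th j),
    variance s (fun a : Th i => base_alloc t (dfwith th i a) i) = 0.

(* The total ordering of the states is the one induced by any given type. *)
Definition regular_values : Prop :=
  forall i (a a' : Th i) (t t' : T i),
    v i a' t <= v i a t <-> v i a' t' <= v i a t'.

Definition regular_virtual_values : Prop :=
  forall i (a a' : Th i) (t t' : T i),
    v i a' t' <= v i a t <-> phi a' t' <= phi a t.

End Auction.

(* Main.v *)
Require Import Defs.
From mathcomp Require Import all_boot all_order all_algebra.
From mathcomp Require Import all_classical all_reals all_analysis.
From HB Require Import structures.
From mathcomp Require Import measurable_realfun lra ring.

Set Implicit Arguments.
Unset Strict Implicit.
Unset Printing Implicit Defensive.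

Import Order.TTheory GRing.Theory Num.Theory.
Import numFieldNormedType.Exports.

Local Open Scope classical_set_scope.
Local Open Scope ring_scope.

(** A report that changes only the type already gives, for each bidder, one
    inequality per pair of types, between utilities averaged over the signals.
    The types of a bidder are totally ordered in the same way by all states, so
    they have a common quantile q; along q the rent U of a type grows at least
    at the rate sum_a y_a v_a', where y_a is his mean allocation weighted by the
    belief in state a.  Integrating this bounds the expected revenue by the
    expected virtual surplus, which is linear in the signal of each bidder and
    hence at most the surplus of Myerson's auction run state by state on the
    product of the own-signal beliefs; there the bound is the payment.
    For incentives, allocation and value are comonotone in the own state, so
    Chebyshev's sum inequality bounds the utility of every report by a function
    linear in the own signal.  Such a function cannot gain from garbling, and
    information sufficiency makes truth attain the bound. *)

(** * Random variables with a density *)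

(** Competing mechanisms are arbitrary: their mean allocations need be neither monotone nor
    continuous in the type, so no differentiable envelope formula is at hand. Only a lower bound on
    rents is needed, and it comes from averaging incentive constraints over short quantile windows
    and applying Fatou's lemma. For Myerson's auction the converse inequality is proved separately,
    by comparing a posted price with its virtual revenue, so no exact payment formula is required.
    Rents and markups are not known to be integrable beforehand. The inequalities are therefore
    stated additively, between integrals of nonnegative functions in the extended reals; finite mean
    values enter only at the end, to cancel common terms. Rationality and information sufficiency
    are assumed on topological supports, whereas utilities are integrals; the link is that the
    support of a law on beliefs has full measure, as finitely many coordinates leave only countably
    many rational balls to discard. *)

Lemma measurable_fun_ge0_inv {d} {T : measurableType d} {R : realType}
    (f : T -> R) :
  measurable_fun setT f -> (forall t, 0 <= f t) ->
  measurable_fun setT (fun t => (f t)^-1).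
Proof.
move=> mf f0; under eq_fun do rewrite -powR_inv1//.
by apply: (measurableT_comp (f := fun x => x `^ (-1))).
Qed.

Section Density.
Context {d} {T : measurableType d} {R : realType} {P : probability T R}.
Variables (X : {RV P >-> R}) (f : R -> R).
Hypothesis mf : measurable_fun setT f.
Hypothesis f0 : forall r, 0 <= f r.
Hypothesis fX : forall B : set R, measurable B ->
  distribution P X B = (\int[lebesgue_measure]_(r in B) (f r)%:E)%E.
Notation mu := (@lebesgue_measure R).
Notation F r := (fine (cdf X r)).

Lemma integrable_density : mu.-integrable setT (EFin \o f).
Proof.
apply/integrableP; split; first exact/measurable_EFinP.
under eq_integral do rewrite gee0_abs ?lee_fin//.
by rewrite -fX// ltey_eq fin_num_measure.
Qed.

(** The law of [X] is dominated by Lebesgue measure, and its Radon-Nikodym derivative agrees almost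
    everywhere with [f], having the same integral over every measurable set. *)
Lemma ge0_integral_density (psi : R -> \bar R) :
  measurable_fun setT psi -> (forall r, 0 <= psi r)%E ->
  (\int[P]_t psi (X t) = \int[mu]_r (psi r * (f r)%:E))%E.
Proof.
move=> mpsi psi0.
(* [lebesgue_measure] lives on [measurableTypeR R], whose display is not that of
   the measurable type [R] of [X]. *)
have mX : @measurable_fun _ _ T (measurableTypeR R) setT X.
  exact: (@measurable_funPT _ _ T R X).
pose X'm := @isMeasurableFun.Build _ _ T (measurableTypeR R) X mX.
pose X' : {mfun T >-> measurableTypeR R} := HB.pack (X : T -> measurableTypeR R) X'm.
pose nu : probability (measurableTypeR R) R := @distribution _ _ T (measurableTypeR R) R P X'.
have nuE B : measurable B -> nu B = (\int[mu]_(r in B) (f r)%:E)%E.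
  by move=> mB; rewrite -fX.
pose la : {sigma_finite_measure set (measurableTypeR R) -> \bar R} := @lebesgue_measure R.
have dom : nu `<< la.
  apply/null_content_dominatesP => A mA A0; rewrite nuE//.
  apply: null_set_integral => //.
  by apply/measurable_EFinP; exact: measurable_funTS.
transitivity (\int[nu]_r psi r)%E.
  by rewrite (ge0_integral_pushforward mX P (D := setT)).
rewrite -(Radon_Nikodym_SigmaFinite.change_of_variables dom)//.
apply: ae_eq_integral => //.
- apply: emeasurable_funM => //.
  exact: measurable_int (Radon_Nikodym_SigmaFinite.f_integrable dom).
- by apply: emeasurable_funM => //; exact/measurable_EFinP.
have : ae_eq mu setT (Radon_Nikodym_SigmaFinite.f nu la) (EFin \o f).
  apply: integral_ae_eq => //.
  - exact: Radon_Nikodym_SigmaFinite.f_integrable dom.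
  - exact/measurable_EFinP.
  - move=> E _ mE; rewrite -(Radon_Nikodym_SigmaFinite.f_integral dom)//=.
    exact: nuE.
by apply: filterS => x /= h _; rewrite h.
Qed.

(** The change of variables brings a factor [f] that cancels the denominator where [f] is positive;
    elsewhere the inverse of 0 is 0, hence the restricted domain on the right. *)
Lemma ge0_integral_div_density (psi : R -> R) :
  measurable_fun setT psi -> (forall r, 0 <= psi r) ->
  (\int[P]_t (psi (X t) / f (X t))%:E
    = \int[mu]_(r in [set r | (0 < f r)%R]) (psi r)%:E)%E.
Proof.
move=> mpsi psi0.
rewrite (ge0_integral_density (psi := fun r => (psi r / f r)%:E)); first last.
- by move=> r; rewrite lee_fin divr_ge0.
- apply/measurable_EFinP; apply: measurable_funM => //.
  exact: measurable_fun_ge0_inv.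
rewrite [RHS]integral_mkcond; apply: eq_integral => r _; rewrite patchE.
rewrite -EFinM; case: ifPn => [|].
  by rewrite inE/= => fr; rewrite -mulrA mulVf ?mulr1 ?gt_eqF.
rewrite notin_setE/= => /negP; rewrite -leNgt => fr.
have -> : f r = 0 by apply/eqP; rewrite eq_le fr f0.
by rewrite mulr0.
Qed.

Lemma density_negligible (N : set R) : mu.-negligible N ->
  P.-negligible (X @^-1` N).
Proof.
move=> [B [mB B0 NB]]; exists (X @^-1` B); split.
- by rewrite -[X in measurable X]setTI; exact: measurable_funP.
- have := fX mB; rewrite null_set_integral//.
  by apply/measurable_EFinP; exact: measurable_funTS.
- exact: preimage_subset.
Qed.

Lemma density_atomless r : P (X @^-1` [set r]) = 0%E.
Proof.
have /= := fX (measurable_set1 r).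
by rewrite integral_set1.
Qed.

Lemma ae_density_gt0 : {ae P, forall t, 0 < f (X t)}.
Proof.
have mA : measurable [set r | f r = 0].
  have -> : [set r | f r = 0] = setT `&` f @^-1` [set 0] by rewrite setTI.
  exact: mf.
exists (X @^-1` [set r | f r = 0]); split.
- by rewrite -[X in measurable X]setTI; exact: measurable_funP.
- rewrite -[LHS]/(distribution P X _) fX//.
  by apply: integral0_eq => r /= ->.
- move=> t /=/negP; rewrite -leNgt => ft.
  by apply/eqP; rewrite eq_le ft f0.
Qed.

Lemma fine_cdf_integral r : F r = \int[mu]_(x in `]-oo, r]) f x.
Proof. by rewrite /cdf fX. Qed.

(** Lebesgue differentiation gives [F] the derivative [f] off a null set, which [X] almost surely
    avoids. Only the upper bound on the right is kept: read backwards, it bounds value increments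
    from below by quantile increments. *)
Lemma ae_cdf_slope : {ae P, forall t, forall e : R, 0 < e -> exists2 eta : R, 0 < eta &
  forall r, X t <= r < X t + eta -> F r - F (X t) <= (f (X t) + e) * (r - X t)}.
Proof.
have fint (A : set R) : measurable A -> mu.-integrable A (EFin \o f).
  by move=> mA; exact: (integrableS measurableT _ _ integrable_density).
have := @FTC1Ny R f (fun y => fint _ (measurable_itv _)).
have locf : locally_integrable [set: R] f.
  split => //; first exact: openT.
  move=> K _ cK; have := fint K (compact_measurable cK).
  by move=> /integrableP[_]; under eq_integral do rewrite /= -abse_EFin.
move=> /(_ locf) /=.
have -> : (fun x : R => \int[mu]_(t in [set` `]-oo, x]]) f t) = (fun r => F r).
  by apply/funext => r; rewrite fine_cdf_integral.
move=> /density_negligible; apply: negligibleS => t /=.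
apply: contra_not => -[dF dFE] e e0.
have : (h^-1 *: (((fun r => F r : R^o) \o shift (X t)) (h *: (1:R)) - F (X t)))
    @[h --> 0^'] --> f (X t).
  by rewrite -dFE derive1E; exact: dF.
move=> /cvgrPdist_lt /(_ _ e0).
rewrite near_withinE near_nbhs => /nbhs_ballP[eta /= eta0 H].
exists eta => // r /andP[Xr rX].
have [->|rNX] := eqVneq r (X t); first by rewrite !subrr mulr0.
have rX0 : 0 < r - X t by rewrite subr_gt0 lt_neqAle eq_sym rNX.
have /= := H (r - X t).
rewrite /ball/= sub0r normrN gtr0_norm// ltrBlDl => /(_ rX) /(_ (lt0r_neq0 rX0)).
rewrite [_ *: 1]mulr1 subrK distrC => /ltW.
rewrite ler_norml => /andP[_]; rewrite lerBlDl.
by rewrite [_ *: _]mulrC ler_pdivrMr.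
Qed.
End Density.

(** * Monotonicity, Tonelli and limits inferior for real integrands *)

Lemma ge0_le_integral_EFin {d} {T : measurableType d} {R : realType}
    (mu : {measure set T -> \bar R}) (f g : T -> R) :
  measurable_fun setT f -> measurable_fun setT g ->
  (forall t, 0 <= f t) -> (forall t, f t <= g t) ->
  (\int[mu]_t (f t)%:E <= \int[mu]_t (g t)%:E)%E.
Proof.
move=> mf mg f0 fg; apply: ge0_le_integral => //.
- by move=> t _; rewrite lee_fin.
- exact/measurable_EFinP.
- exact/measurable_EFinP.
- by move=> t _; rewrite lee_fin.
Qed.

Lemma measurable_fun_section {d d1 d2} {T1 : measurableType d1} {T2 : measurableType d2}
    {V : measurableType d} (F : T1 -> T2 -> V) x :
  measurable_fun setT (fun z => F z.1 z.2) -> measurable_fun setT (F x).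
Proof. by move=> mF; exact: (measurableT_comp mF (measurable_pair1 x)). Qed.

Lemma measurable_integral_EFin {d1 d2} {T1 : measurableType d1}
    {T2 : measurableType d2} {R : realType}
    (mu : {sigma_finite_measure set T2 -> \bar R}) (F : T1 -> T2 -> R) :
  measurable_fun setT (fun z => F z.1 z.2) -> (forall x y, 0 <= F x y) ->
  measurable_fun setT (fun x => \int[mu]_y (F x y)%:E)%E.
Proof.
move=> mF F0.
apply: (@measurable_fun_fubini_tonelli_F _ _ _ _ _ mu (fun z => (F z.1 z.2)%:E)).
  exact/measurable_EFinP.
by move=> z; rewrite lee_fin.
Qed.

Lemma exchange_integral_EFin {d1 d2} {T1 : measurableType d1}
    {T2 : measurableType d2} {R : realType}
    (mu1 : {sigma_finite_measure set T1 -> \bar R})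
    (mu2 : {sigma_finite_measure set T2 -> \bar R}) (F : T1 -> T2 -> R) :
  measurable_fun setT (fun z => F z.1 z.2) -> (forall x y, 0 <= F x y) ->
  (\int[mu1]_x \int[mu2]_y (F x y)%:E = \int[mu2]_y \int[mu1]_x (F x y)%:E)%E.
Proof.
move=> mF F0.
apply: (@fubini_tonelli _ _ _ _ _ mu1 mu2 (fun z => (F z.1 z.2)%:E)).
  exact/measurable_EFinP.
by move=> z; rewrite lee_fin.
Qed.

Lemma limn_einf_ge {R : realType} (u : (\bar R)^nat) (c : \bar R) :
  (\forall k \near \oo, (c <= u k)%E) -> (c <= limn_einf u)%E.
Proof.
move=> cu; rewrite limn_einf_lim; apply: lime_ge; first exact: is_cvg_einfs.
case: cu => N _ cu; near=> m; apply: le_ereal_inf_tmp => _ [k /= mk <-].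
by apply: cu => /=; rewrite (leq_trans _ mk)//; near: m; exists N.
Unshelve. all: by end_near. Qed.

Lemma limn_einf_le_cvg {R : realType} (u : (\bar R)^nat) (a : R^nat) (l : R) :
  (forall k, (u k <= (a k)%:E)%E) -> a @ \oo --> l -> (limn_einf u <= l%:E)%E.
Proof.
move=> ua al.
have al' : EFin \o a @ \oo --> l%:E.
  by apply: cvg_EFin => //; exact: nearW.
have /cvg_lim <- // := al'.
rewrite limn_einf_lim; apply: lee_lim; first exact: is_cvg_einfs.
  by apply/cvg_ex; exists l%:E.
near=> k; apply: le_trans (ua k).
by apply: ereal_inf_lbound; exists k => /=.
Unshelve. all: by end_near. Qed.

Lemma ge0_integralD_EFin {d} {T : measurableType d} {R : realType}
    (mu : {measure set T -> \bar R}) (F G : T -> R) :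
  measurable_fun setT F -> measurable_fun setT G ->
  (forall t, 0 <= F t) -> (forall t, 0 <= G t) ->
  (\int[mu]_t (F t + G t)%:E = \int[mu]_t (F t)%:E + \int[mu]_t (G t)%:E)%E.
Proof.
move=> mF mG F0 G0; under eq_integral do rewrite EFinD.
rewrite ge0_integralD//.
- by move=> t _; rewrite lee_fin.
- exact/measurable_EFinP.
- by move=> t _; rewrite lee_fin.
- exact/measurable_EFinP.
Qed.

(** * The envelope inequality *)

Section Envelope.
Context {d} {T : measurableType d} {R : realType} (P : probability T R).
Context {A : finType} (q U : T -> R) (y v f : A -> T -> R).
(* [U t] is the rent of type [t], [q t] his quantile, [y a t] his mean allocation
   weighted by the belief in state [a], [v a t] his value in that state, and
   [f a t] the density of the value at [v a t]. *)
Hypothesis mq : measurable_fun setT q.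
Hypothesis mU : measurable_fun setT U.
Hypothesis my : forall a, measurable_fun setT (y a).
Hypothesis mv : forall a, measurable_fun setT (v a).
Hypothesis mf : forall a, measurable_fun setT (f a).
Hypothesis q_uniform : forall u : R, 0 <= u <= 1 -> P [set t | q t <= u] = u%:E.
Hypothesis q_ge0 : forall t, 0 <= q t.
Hypothesis q_le1 : forall t, q t <= 1.
Hypothesis y_ge0 : forall a t, 0 <= y a t.
Hypothesis f_ge0 : forall a t, 0 <= f a t.
Hypothesis v_mono : forall a t t', q t <= q t' -> v a t <= v a t'.
Hypothesis slope : {ae P, forall t a, 0 < f a t /\
  forall e : R, 0 < e -> exists2 eta : R, 0 < eta & forall t', q t < q t' < q t + eta ->
    q t' - q t <= (f a t + e) * (v a t' - v a t)}.
Hypothesis U_ge0 : forall t, 0 <= U t.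
Hypothesis IC : forall t t',
  U t + \sum_a y a t * (v a t' - v a t) <= U t'.

Lemma measurable_quantile (Q : set R) : measurable Q -> measurable (q @^-1` Q).
Proof. by move=> mQ; rewrite -[X in measurable X]setTI; exact: mq. Qed.

Lemma quantile_itv_eq (a b : R) : 0 <= a -> a <= b -> b <= 1 ->
  P [set t | a < q t <= b] = (b - a)%:E.
Proof.
move=> a0 ab b1.
have -> : [set t | a < q t <= b] = [set t | q t <= b] `\` [set t | q t <= a].
  apply/seteqP; split => t /=; first by move=> /andP[at_ ->]; split => //; apply/negP; rewrite -ltNge.
  by move=> [-> /negP]; rewrite -ltNge => ->.
have mI (c : R) : measurable [set t | q t <= c].
  have -> : [set t | q t <= c] = q @^-1` `]-oo, c].
    by apply/seteqP; split => t; rewrite /= in_itv.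
  exact: measurable_quantile.
rewrite measureD//=; last first.
  by rewrite q_uniform ?(le_trans a0)// ltry.
rewrite setIidr; last by move=> t /= /le_trans; exact.
by rewrite !q_uniform ?a0 ?(le_trans a0 ab) ?(le_trans ab b1)// -EFinB.
Qed.

(** The interval is closed and its endpoints are arbitrary reals, while the uniform law concerns
    lower sets at levels in [0, 1]. So [a] is lowered by [e], [b] is cut at 1, and [e] tends to
    0. *)
Lemma quantile_itv_le (a b : R) : a <= b ->
  (P [set t | (a <= q t <= b)%R] <= (b - a)%:E)%E.
Proof.
move=> ab.
have mI (B : itv_bound R) (C : itv_bound R) : measurable (q @^-1` [set` Interval B C]).
  exact: measurable_quantile.
have mcc : measurable [set t | (a <= q t <= b)%R].
  by have -> : [set t | (a <= q t <= b)%R] = q @^-1` `[a, b] by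
    apply/seteqP; split => t; rewrite /= in_itv.
apply/lee_addgt0Pr => e e0.
have [b0|b0] := ltP b 0.
  rewrite (_ : [set t | _] = set0) ?measure0 -?EFinD ?lee_fin; first lra.
  by rewrite -subset0 => t /= /andP[_]; have := q_ge0 t; lra.
have [a1|a1] := ltP 1 (a - e).
  rewrite (_ : [set t | _] = set0) ?measure0 -?EFinD ?lee_fin; first lra.
  by rewrite -subset0 => t /= /andP[]; have := q_le1 t; lra.
have [ae0|ae0] := ltP (a - e) 0.
  apply: (@le_trans _ _ (P [set t | q t <= Num.min 1 b])).
    apply: le_measure; rewrite ?inE//.
      have -> : [set t | (q t <= Num.min 1 b)%R] = q @^-1` `]-oo, Num.min 1 b] by
        apply/seteqP; split => t; rewrite /= in_itv.
      exact: mI.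
    by move=> t /= /andP[_ tb]; rewrite le_min q_le1.
  rewrite q_uniform; last by rewrite le_min ge_min lexx b0 ler01.
  by rewrite -EFinD lee_fin ge_min; apply/orP; right; lra.
apply: (@le_trans _ _ (P [set t | a - e < q t <= Num.min 1 b])).
  apply: le_measure; rewrite ?inE//.
    have -> : [set t | a - e < q t <= Num.min 1 b] = q @^-1` `]a - e, Num.min 1 b] by
      apply/seteqP; split => t; rewrite /= in_itv.
    exact: mI.
  by move=> t /= /andP[at_ tb]; rewrite le_min q_le1 tb/= andbT; lra.
rewrite quantile_itv_eq//.
- rewrite -EFinD lee_fin.
  have : Num.min 1 b <= b by rewrite ge_min lexx orbT.
  by lra.
- by rewrite le_min a1/=; lra.
- by rewrite ge_min lexx.
Qed.

Lemma measurable_quantile_itv (a b : R) : measurable [set t | a <= q t <= b].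
Proof.
have -> : [set t | a <= q t <= b] = q @^-1` `[a, b].
  by apply/seteqP; split => t; rewrite /= in_itv.
exact: measurable_quantile.
Qed.

Lemma rent_mono t t' : q t <= q t' -> U t <= U t'.
Proof.
move=> qtt'; apply: le_trans (IC t t'); rewrite lerDl sumr_ge0// => a _.
by rewrite mulr_ge0// subr_ge0 v_mono.
Qed.

(* Only deviations from types [t'] in the window of [t] to [t] are used.  Its
   distance [eps] and width [eta] are later 1/k and 1/k^2: the increments of [v]
   across it are then at least [eps] divided by the density, up to o(eps), while
   the sums of the increments of [U] telescope up to a factor 1 + eta/eps. *)
Definition window (Q eps eta : R) (t t' : T) : R :=
  ((q t + eps < q t' <= q t + (eps + eta)) && (q t' <= Q))%:R.

Lemma window_ge0 Q eps eta t t' : 0 <= window Q eps eta t t'.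
Proof. exact: ler0n. Qed.

Lemma measurable_window Q eps eta :
  measurable_fun setT (fun z => window Q eps eta z.1 z.2).
Proof.
have mq1 : measurable_fun setT (fun z : T * T => q z.1).
  exact: measurableT_comp mq measurable_fst.
have mq2 : measurable_fun setT (fun z : T * T => q z.2).
  exact: measurableT_comp mq measurable_snd.
apply: (measurableT_comp (f := fun b : bool => b%:R : R)) => //.
apply: measurable_and; last exact: measurable_fun_ler.
apply: measurable_and.
  by apply: measurable_fun_ltr => //; exact: measurable_funD.
by apply: measurable_fun_ler => //; exact: measurable_funD.
Qed.

Lemma window_sum_ge0 Q eps eta t t' : 0 < eps ->
  0 <= window Q eps eta t t' * \sum_a y a t * (v a t' - v a t).
Proof.
move=> eps0.
rewrite /window; case: andP => [[/andP[qt _] _]|_]; last by rewrite mul0r.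
rewrite mul1r sumr_ge0// => a _; rewrite mulr_ge0// subr_ge0 v_mono//.
by rewrite ltW// (le_lt_trans _ qt)// lerDl ltW.
Qed.

(** Sum the incentive constraints over all pairs in a window: apart from boundary terms, each rent
    appears with weight [eta] on both sides. What survives are types within [eps + eta] below the
    quantile of [ts], whose rent is at most [U ts]. *)
Lemma window_bound (ts : T) (eps eta : R) : 0 < eps -> 0 < eta ->
  (\int[P]_t \int[P]_t' (window (q ts) eps eta t t' *
     \sum_a y a t * (v a t' - v a t))%:E <= (U ts * (eta * (eps + eta)))%:E)%E.
Proof.
move=> eps0 eta0; set Q := q ts; set N := window Q eps eta.
have mN : measurable_fun setT (fun z => N z.1 z.2) by exact: measurable_window.
pose S t t' := \sum_a y a t * (v a t' - v a t).
have mS : measurable_fun setT (fun z => S z.1 z.2).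
  apply: measurable_sum => a; apply: measurable_funM.
    exact: measurableT_comp (my a) measurable_fst.
  apply: measurable_funB.
    exact: measurableT_comp (mv a) measurable_snd.
  exact: measurableT_comp (mv a) measurable_fst.
have NS0 t t' : 0 <= N t t' * S t t' by exact: window_sum_ge0.
have mNS : measurable_fun setT (fun z => N z.1 z.2 * S z.1 z.2).
  exact: measurable_funM.
have mNU : measurable_fun setT (fun z => N z.1 z.2 * U z.1).
  by apply: measurable_funM => //; exact: measurableT_comp mU measurable_fst.
have mNU' : measurable_fun setT (fun z => N z.1 z.2 * U z.2).
  by apply: measurable_funM => //; exact: measurableT_comp mU measurable_snd.
have N0 t t' : 0 <= N t t' by exact: window_ge0.
(* The rent common to both sides. Truncating the quantile bounds it through [U ts], so it is finite
   and can be cancelled without integrability of [U]. *)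
pose J := (\int[P]_t (eta * U t * (q t <= Q - (eps + eta))%R%:R)%R%:E)%E.
have mle (c : R) : measurable_fun setT (fun t => (q t <= c)%R%:R : R).
  apply: (measurableT_comp (f := fun b : bool => b%:R : R)) => //.
  exact: measurable_fun_ler.
have mJ (c : R) : measurable_fun setT (fun t => eta * U t * (q t <= c)%R%:R).
  by apply: measurable_funM => //; exact: measurable_funM.
have J0 (c : R) t : 0 <= eta * U t * (q t <= c)%R%:R.
  by rewrite mulr_ge0// mulr_ge0// ltW.
have Jle : (J <= (eta * U ts)%:E)%E.
  rewrite -[leRHS]mule1 -(@probability_setT _ _ _ P) -integral_cst//.
  apply: (@ge0_le_integral_EFin _ _ _ P _ (cst (eta * U ts))) => // t.
  have [qt|_] := lerP (q t); last by rewrite mulr0 mulr_ge0// ltW.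
  rewrite mulr1 (ler_wpM2l (ltW eta0))// rent_mono// (le_trans qt)//.
  by rewrite gerBl addr_ge0 ?ltW.
have Jfin : J \is a fin_num.
  rewrite ge0_fin_numE ?(le_lt_trans Jle) ?ltry//.
  by apply: integral_ge0 => t _; rewrite lee_fin.
(* The constraint that [t'] does not gain from posing as [t], weighted by the window. *)
have I13 : (\int[P]_t \int[P]_t' (N t t' * U t)%:E +
            \int[P]_t \int[P]_t' (N t t' * S t t')%:E <=
            \int[P]_t \int[P]_t' (N t t' * U t')%:E)%E.
  rewrite -ge0_integralD//; last 4 first.
  - by move=> t _; apply: integral_ge0 => t' _; rewrite lee_fin mulr_ge0.
  - by apply: measurable_integral_EFin => // *; rewrite mulr_ge0.
  - by move=> t _; apply: integral_ge0 => t' _; rewrite lee_fin.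
  - exact: measurable_integral_EFin.
  apply: ge0_le_integral => //.
  - move=> t _; apply: adde_ge0; apply: integral_ge0 => t' _; rewrite lee_fin//.
    by rewrite mulr_ge0.
  - apply: emeasurable_funD; apply: measurable_integral_EFin => // *.
    by rewrite mulr_ge0.
  - by apply: measurable_integral_EFin => // *; rewrite mulr_ge0.
  move=> t _; rewrite -ge0_integralD//; last 4 first.
  - by move=> t' _; rewrite lee_fin mulr_ge0.
  - apply/measurable_EFinP; exact: (measurable_fun_section (F := fun t t' => N t t' * U t) _ mNU).
  - by move=> t' _; rewrite lee_fin.
  - apply/measurable_EFinP; exact: (measurable_fun_section (F := fun t t' => N t t' * S t t') _ mNS).
  under eq_integral do rewrite -EFinD.
  apply: ge0_le_integral_EFin.
  - apply: measurable_funD; first exact: (measurable_fun_section (F := fun t t' => N t t' * U t) _ mNU).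
    exact: (measurable_fun_section (F := fun t t' => N t t' * S t t') _ mNS).
  - exact: (measurable_fun_section (F := fun t t' => N t t' * U t') _ mNU').
  - by move=> t'; rewrite addr_ge0// mulr_ge0.
  - by move=> t'; rewrite -mulrDr ler_wpM2l//; exact: IC.
(* A given [t'] is in the window of types from a quantile interval of length [eta], hence of
   probability at most [eta]. The excess over [J] is carried by quantiles between [Q - (eps + eta)]
   and [Q]. *)
have I3 : (\int[P]_t \int[P]_t' (N t t' * U t')%:E <=
    J + (U ts * (eta * (eps + eta)))%:E)%E.
  rewrite (exchange_integral_EFin P P mNU'); last first.
    by move=> t t'; rewrite mulr_ge0.
  apply: (@le_trans _ _ (\int[P]_t (eta * U t * (q t <= Q)%R%:R)%:E)%E).
    apply: ge0_le_integral => //.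
    - by move=> t _; apply: integral_ge0 => t' _; rewrite lee_fin mulr_ge0.
    - apply: (@measurable_integral_EFin _ _ _ _ _ P (fun t' t => N t t' * U t')).
        exact: (measurableT_comp mNU' (@measurable_swap _ _ _ _)).
      by move=> *; rewrite mulr_ge0.
    - exact/measurable_EFinP.
    move=> t' _.
    have [qt|qt] := lerP (q t') Q; last first.
      rewrite mulr0 integral0_eq// => t _.
      by rewrite /N /window [_ <= Q]leNgt qt andbF mul0r.
    rewrite mulr1; under eq_integral do rewrite mulrC EFinM.
    rewrite ge0_integralZl_EFin//; last 2 first.
    - by move=> t _; rewrite lee_fin.
    - apply/measurable_EFinP.
      exact: (measurable_fun_section (F := fun t' t => N t t') _
        (measurableT_comp mN (@measurable_swap _ _ _ _))).
    rewrite [(eta * _)%:E]EFinM [leRHS]muleC lee_wpmul2l ?lee_fin//.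
    have mB := measurable_quantile_itv (q t' - (eps + eta)) (q t' - eps).
    apply: (@le_trans _ _ (\int[P]_t (\1_[set t | (q t' - (eps + eta) <= q t <= q t' - eps)%R] t)%:E)%E).
      apply: ge0_le_integral_EFin => //.
        exact: (measurable_fun_section (F := fun t' t => N t t') _
          (measurableT_comp mN (@measurable_swap _ _ _ _))).
      move=> t; rewrite indicE /N /window; case: andP => [[/andP[h1 h2] _]|_//].
      by rewrite mem_set//=; apply/andP; split; lra.
    rewrite integral_indic// setIT (le_trans (quantile_itv_le _))//.
      by lra.
    by rewrite lee_fin; lra.
  have mB := measurable_quantile_itv (Q - (eps + eta)) Q.
  set B := [set t | _] in mB.
  have mI : measurable_fun setT (fun t => U ts * eta * \1_B t).
    by apply: measurable_funM => //.
  apply: (@le_trans _ _ (J + \int[P]_t (U ts * eta * \1_B t)%:E)%E).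
    rewrite -ge0_integralD//; last 4 first.
    - by move=> t _; rewrite lee_fin.
    - exact/measurable_EFinP.
    - by move=> t _; rewrite lee_fin mulr_ge0// mulr_ge0// ltW.
    - exact/measurable_EFinP.
    under [leRHS]eq_integral do rewrite -EFinD.
    apply: ge0_le_integral_EFin => //; first exact: measurable_funD.
    move=> t; have [qt|qt] := lerP (q t) Q; last first.
      by rewrite mulr0 addr_ge0// mulr_ge0// mulr_ge0// ltW.
    have [qt'|qt'] := lerP (q t) (Q - (eps + eta)).
      by rewrite lerDl mulr_ge0// mulr_ge0// ltW.
    rewrite mulr0 add0r indicE mem_set ?/B/= ?(ltW qt') ?qt// !mulr1 mulrC.
    by rewrite ler_wpM2r ?(ltW eta0)// rent_mono.
  rewrite leeD2l//; under eq_integral do rewrite EFinM.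
  rewrite ge0_integralZl_EFin//; last 2 first.
  - exact/measurable_EFinP.
  - by rewrite mulr_ge0// ltW.
  rewrite integral_indic// setIT mulrA [(_ * _ * (_ + _))%:E]EFinM lee_wpmul2l//.
    by rewrite lee_fin mulr_ge0// ltW.
  apply: le_trans (quantile_itv_le _) _; first lra.
  by rewrite lee_fin; lra.
(* When [q t] is at most [Q - (eps + eta)], the whole window fits below [Q] and has probability
   exactly [eta]. *)
have I1 : (J <= \int[P]_t \int[P]_t' (N t t' * U t)%:E)%E.
  apply: ge0_le_integral => //.
  - by move=> t _; rewrite lee_fin.
  - exact/measurable_EFinP.
  - by apply: measurable_integral_EFin => // *; rewrite mulr_ge0.
  move=> t _; have [qt|qt] := lerP (q t) (Q - (eps + eta)); last first.
    by rewrite mulr0 integral_ge0// => t' _; rewrite lee_fin mulr_ge0.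
  rewrite mulr1; under eq_integral do rewrite mulrC EFinM.
  have mNt : measurable_fun setT (N t) by exact: (measurable_fun_section _ mN).
  rewrite ge0_integralZl_EFin//; last 2 first.
  - by move=> t' _; rewrite lee_fin.
  - exact/measurable_EFinP.
  rewrite mulrC EFinM lee_wpmul2l ?lee_fin//.
  have Q1 : Q <= 1 by exact: q_le1.
  have := quantile_itv_eq (a := q t + eps) (b := q t + (eps + eta)).
  rewrite (_ : _ - _ = eta); last by ring.
  move=> <-; last 3 first.
  - by rewrite addr_ge0// ltW.
  - by lra.
  - by lra.
  set C := [set t' | _].
  have mC : measurable C.
    have -> : C = q @^-1` `]q t + eps, q t + (eps + eta)].
      by apply/seteqP; split => t'; rewrite /= in_itv.
    exact: measurable_quantile.
  rewrite -[C]setIT -integral_indic//.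
  apply: ge0_le_integral_EFin => // t'.
  rewrite indicE /N /window; have [/set_mem /= h|_ //] := boolP (t' \in C).
  by move: h => /[dup] /andP[_ h] ->/=; rewrite (le_trans h)//; lra.
rewrite -(@leeD2lE _ J)//; apply: le_trans I3; apply: le_trans I13.
by rewrite leeD2r.
Qed.

(** A window that fits below [q ts] has probability [eta], and on it the quantile has grown by more
    than [eps]; slopes at least [c a] thus yield the factor [eps * eta]. *)
Lemma window_mean_ge (ts t : T) (eps eta : R) (c : A -> R) :
  0 < eps -> 0 < eta -> q t + (eps + eta) <= q ts ->
  (forall a, 0 <= c a) ->
  (forall a t', q t < q t' <= q t + (eps + eta) ->
     c a * (q t' - q t) <= v a t' - v a t) ->
  ((eps * eta * \sum_a y a t * c a)%:E <= \int[P]_t' (window (q ts) eps eta t t' *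
     \sum_a y a t * (v a t' - v a t))%:E)%E.
Proof.
move=> eps0 eta0 qts c0 slopec.
set C := [set t' | q t + eps < q t' <= q t + (eps + eta)].
have mC : measurable C.
  have -> : C = q @^-1` `]q t + eps, q t + (eps + eta)].
    by apply/seteqP; split => t'; rewrite /= in_itv.
  exact: measurable_quantile.
have yc0 : 0 <= \sum_a y a t * c a by apply: sumr_ge0 => a _; rewrite mulr_ge0.
have PC : P C = eta%:E.
  rewrite quantile_itv_eq; last 3 first.
  - by rewrite addr_ge0// ltW.
  - by rewrite lerD2l lerDl ltW.
  - exact: le_trans qts _.
  by congr (_%:E); ring.
have -> : (eps * eta * \sum_a y a t * c a)%:E =
    (\int[P]_t' (eps * (\sum_a y a t * c a) * \1_C t')%:E)%E.
  under eq_integral do rewrite EFinM.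
  rewrite ge0_integralZl_EFin//; last 2 first.
  - exact/measurable_EFinP.
  - by rewrite mulr_ge0// ltW.
  rewrite integral_indic// setIT.
  transitivity ((eps * \sum_a y a t * c a)%:E * eta%:E)%E.
    by rewrite -EFinM; congr (_%:E); ring.
  by congr (_ * _)%E; exact/esym.
apply: ge0_le_integral_EFin.
- exact: measurable_funM.
- apply: measurable_funM.
    exact: (measurable_fun_section (F := window (q ts) eps eta) _ (measurable_window _ _ _)).
  apply: measurable_sum => a; apply: measurable_funM => //.
  exact: measurable_funB.
- by move=> t'; rewrite mulr_ge0// mulr_ge0// ltW.
move=> t'; rewrite indicE /window; have [/set_mem /= h|] := boolP (t' \in C); last first.
  rewrite notin_setE => /negP /= h.
  by rewrite mulr0 window_sum_ge0.
have qt' : q t < q t' by case/andP: h => h _; rewrite (le_lt_trans _ h)// lerDl ltW.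
have h2 : q t' <= q ts by case/andP: h => _ h; exact: le_trans h qts.
rewrite h h2 mulr1 mul1r mulr_sumr ler_sum// => a _.
rewrite mulrCA ler_wpM2l//.
apply: le_trans (slopec a t' _); last by case/andP: h => _ ->; rewrite qt'.
by rewrite mulrC ler_wpM2l//; case/andP: h => h _; lra.
Qed.

(** With [eps = e] and [eta = e ^ 2], dividing [window_bound] by [eps * eta = e ^ 3] leaves
    [U ts * (1 + e)]. Almost surely the normalised window mean has a limit inferior of at least the
    integrand on the left; Fatou's lemma joins the two as [e] tends to 0. *)
Lemma envelope_pointwise ts :
  (\int[P]_t ((q t < q ts)%R%:R * \sum_a y a t / f a t)%:E <= (U ts)%:E)%E.
Proof.
pose e k : R := k.+1%:R^-1.
have e0 k : 0 < e k by rewrite invr_gt0.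
have e1 k : e k <= 1 by rewrite invf_le1 ?ler1n.
pose S t t' := \sum_a y a t * (v a t' - v a t).
pose G k t := (\int[P]_t' ((e k ^+ 3)^-1 * (window (q ts) (e k) (e k ^+ 2) t t' * S t t'))%:E)%E.
have mWS' k : measurable_fun setT
    (fun z => window (q ts) (e k) (e k ^+ 2) z.1 z.2 * S z.1 z.2).
  apply: measurable_funM; first exact: measurable_window.
  apply: measurable_sum => a; apply: measurable_funM.
    exact: measurableT_comp (my a) measurable_fst.
  apply: measurable_funB.
    exact: measurableT_comp (mv a) measurable_snd.
  exact: measurableT_comp (mv a) measurable_fst.
have mWS k : measurable_fun setT
    (fun z => (e k ^+ 3)^-1 * (window (q ts) (e k) (e k ^+ 2) z.1 z.2 * S z.1 z.2)).
  exact: measurable_funM.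
have WS0 k t t' : 0 <= (e k ^+ 3)^-1 * (window (q ts) (e k) (e k ^+ 2) t t' * S t t').
  by rewrite mulr_ge0 ?window_sum_ge0// invr_ge0 exprn_ge0// ltW.
have mG k : measurable_fun setT (G k) by exact: measurable_integral_EFin.
have G0 k t : (0 <= G k t)%E by apply: integral_ge0 => t' _; rewrite lee_fin.
have GE k t : G k t = ((e k ^+ 3)^-1%:E * \int[P]_t' (window (q ts) (e k) (e k ^+ 2) t t' * S t t')%:E)%E.
  rewrite /G; under eq_integral do rewrite EFinM.
  rewrite ge0_integralZl_EFin//.
  - by move=> t' _; rewrite lee_fin window_sum_ge0.
  - apply/measurable_EFinP.
    exact: (measurable_fun_section (F := fun t t' => window (q ts) (e k) (e k ^+ 2) t t' * S t t') _ (mWS' k)).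
  - by rewrite invr_ge0 exprn_ge0// ltW.
have IG k : (\int[P]_t G k t <= (U ts * (1 + e k))%:E)%E.
  under eq_integral do rewrite GE.
  rewrite ge0_integralZl//; last 3 first.
  - by apply: measurable_integral_EFin => // *; exact: window_sum_ge0.
  - by move=> t _; apply: integral_ge0 => t' _; rewrite lee_fin window_sum_ge0.
  - by rewrite lee_fin invr_ge0 exprn_ge0// ltW.
  have := window_bound ts (e0 k) (exprn_gt0 2 (e0 k)).
  move=> /(lee_wpmul2l (x := (e k ^+ 3)^-1%:E)) H.
  apply: le_trans (H _) _; first by rewrite lee_fin invr_ge0 exprn_ge0// ltW.
  rewrite -EFinM lee_fin le_eqVlt; apply/orP; left; apply/eqP.
  by field; rewrite gt_eqF.
have ecvg : e @ \oo --> (0 : R) by exact: cvg_harmonic.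
have liminfG : {ae P, forall t, (((q t < q ts)%R%:R * \sum_a y a t / f a t)%:E <= limn_einf (G ^~ t))%E}.
  move: slope; apply: filterS => t slopet.
  have [qt|_] := ltrP (q t) (q ts); last first.
    by rewrite mul0r; apply: limn_einf_ge; exact: nearW.
  rewrite mul1r; apply/lee_addgt0Pr => r r0.
  (* Replacing [f] by [f + delta] costs at most [delta] times the sum of [y / f ^ 2], hence at most
     [r]; the summand 1 keeps the denominator positive. *)
  pose delta := r / (1 + \sum_a y a t / f a t ^+ 2).
  have s0 : 0 <= \sum_a y a t / f a t ^+ 2.
    by apply: sumr_ge0 => a _; rewrite divr_ge0// sqr_ge0.
  have delta0 : 0 < delta by rewrite divr_gt0// ltr_pwDl.
  apply: (@le_trans _ _ ((\sum_a y a t / (f a t + delta))%:E + r%:E)%E).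
    rewrite -EFinD lee_fin -lerBlDl -sumrB.
    apply: (@le_trans _ _ (\sum_a delta * (y a t / f a t ^+ 2))).
      apply: ler_sum => a _; have [fa0 _] := slopet a.
      rewrite -mulrBr mulrCA ler_wpM2l//.
      rewrite -subr_ge0 (_ : _ - _ = delta ^+ 2 / (f a t ^+ 2 * (f a t + delta))).
        by rewrite divr_ge0// ?sqr_ge0// mulr_ge0 ?sqr_ge0// addr_ge0// ltW.
      by field; rewrite !gt_eqF// addr_gt0.
    rewrite -mulr_sumr /delta mulrAC ler_pdivrMr ?ltr_pwDl//.
    by rewrite ler_wpM2l ?(ltW r0)// lerDr.
  rewrite leeD2r//; apply: limn_einf_ge.
  (* For large [k] the window lies in the range where the slope estimate with error [delta] holds,
     because [e + e ^ 2] is at most [2 * e]. *)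
  have /filter_forall H : forall a, \forall k \near \oo, forall t', q t < q t' <= q t + (e k + e k ^+ 2) ->
     (f a t + delta)^-1 * (q t' - q t) <= v a t' - v a t.
    move=> a; have [fa0 /(_ _ delta0)[eta eta0 Heta]] := slopet a.
    have : \forall k \near \oo, e k < eta / 2.
      by apply: (cvgr_lt (0 : R)) => //; rewrite divr_gt0.
    apply: filterS => k ek t' /andP[qt' qt''].
    rewrite ler_pdivrMl ?addr_gt0//; apply: Heta; rewrite qt'/=.
    apply: le_lt_trans qt'' _; rewrite ltrD2l.
    have : e k ^+ 2 <= e k by rewrite expr2 ger_pMr.
    lra.
  have : \forall k \near \oo, e k < (q ts - q t) / 2.
    by apply: (cvgr_lt (0 : R)) => //; rewrite divr_gt0// subr_gt0.
  move: H; apply: filterS2 => k H ek.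
  rewrite GE.
  have /(lee_wpmul2l (x := (e k ^+ 3)^-1%:E)) :
    ((e k * e k ^+ 2 * \sum_a y a t * (f a t + delta)^-1)%:E <=
     \int[P]_t' (window (q ts) (e k) (e k ^+ 2) t t' *
     \sum_a y a t * (v a t' - v a t))%:E)%E.
    apply: window_mean_ge => //; first by rewrite exprn_gt0.
      have : e k ^+ 2 <= e k by rewrite expr2 ger_pMr.
      lra.
    by move=> a; rewrite invr_ge0 addr_ge0// ltW.
  move=> H2; apply: le_trans (H2 _); last first.
    by rewrite lee_fin invr_ge0 exprn_ge0// ltW.
  rewrite -EFinM lee_fin -exprS mulrA mulVf ?mul1r//.
  by rewrite expf_eq0/= gt_eqF.
have mlim : measurable_fun setT (fun t => limn_einf (G ^~ t)).
  rewrite /limn_einf; apply: measurableT_comp => //.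
  by apply: measurable_fun_limn_esup => k; exact: measurableT_comp.
apply: (@le_trans _ _ (\int[P]_t limn_einf (G ^~ t))%E).
  apply: ae_ge0_le_integral => //.
  - move=> t _; rewrite lee_fin mulr_ge0// sumr_ge0// => a _.
    by rewrite divr_ge0.
  - apply/measurable_EFinP; apply: measurable_funM.
      apply: (measurableT_comp (f := fun b : bool => b%:R : R)) => //.
      exact: measurable_fun_ltr.
    apply: measurable_sum => a; apply: measurable_funM => //.
    exact: measurable_fun_ge0_inv.
  - by move=> t _; apply: limn_einf_ge; exact: nearW.
  by move: liminfG; apply: filterS.
apply: le_trans (fatou _ _ _ _) _ => //.
apply: (limn_einf_le_cvg IG).
rewrite -[U ts in X in _ --> X]mulr1; apply: cvgMr.
rewrite -[X in _ --> X]addr0.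
by apply: cvgD => //; exact: cvg_cst.
Qed.

(** Integrate the pointwise bound over [ts] and exchange the integrals: the term of [t] is counted
    once for every [ts] of larger quantile, that is with probability [1 - q t]. *)
Lemma envelope_rent :
  (\int[P]_t ((1 - q t) * \sum_a y a t / f a t)%:E <= \int[P]_t (U t)%:E)%E.
Proof.
have g0 t : 0 <= \sum_a y a t / f a t by apply: sumr_ge0 => a _; rewrite divr_ge0.
have mg : measurable_fun setT (fun t => \sum_a y a t / f a t).
  by apply: measurable_sum => a; apply: measurable_funM => //; exact: measurable_fun_ge0_inv.
pose F t ts := (q t < q ts)%R%:R * \sum_a y a t / f a t.
have F0 t ts : 0 <= F t ts by rewrite mulr_ge0.
have mF : measurable_fun setT (fun z => F z.1 z.2).
  apply: measurable_funM; last exact: measurableT_comp mg measurable_fst.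
  apply: (measurableT_comp (f := fun b : bool => b%:R : R)) => //.
  apply: measurable_fun_ltr; first exact: measurableT_comp mq measurable_fst.
  exact: measurableT_comp mq measurable_snd.
apply: (@le_trans _ _ (\int[P]_ts \int[P]_t (F t ts)%:E)%E); last first.
  apply: ge0_le_integral => //.
  - by move=> ts _; apply: integral_ge0 => t _; rewrite lee_fin.
  - apply: (@measurable_integral_EFin _ _ _ _ _ P (fun ts t => F t ts)) => //.
    exact: (measurableT_comp mF (@measurable_swap _ _ _ _)).
  - exact/measurable_EFinP.
  - by move=> ts _; exact: envelope_pointwise.
rewrite -(exchange_integral_EFin P P mF)//.
apply: ge0_le_integral => //.
- by move=> t _; rewrite lee_fin mulr_ge0// subr_ge0.
- by apply/measurable_EFinP; apply: measurable_funM => //; exact: measurable_funB.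
- exact: measurable_integral_EFin.
move=> t _; rewrite /F; under [leRHS]eq_integral do rewrite mulrC EFinM.
rewrite ge0_integralZl_EFin//; last first.
- apply/measurable_EFinP.
  apply: (measurableT_comp (f := fun b : bool => b%:R : R)) => //.
  exact: measurable_fun_ltr.
rewrite mulrC EFinM lee_wpmul2l ?lee_fin//.
have <- := @quantile_itv_eq (q t) 1 (q_ge0 t) (q_le1 t) (lexx _).
set C := [set t' | _].
have CE : C = q @^-1` `]q t, 1] by apply/seteqP; split => t'; rewrite /= in_itv.
have mC : measurable C by rewrite CE; exact: measurable_quantile.
rewrite -[C]setIT -integral_indic//.
apply: ge0_le_integral_EFin => //.
  apply: (measurableT_comp (f := fun b : bool => b%:R : R)) => //.
  exact: measurable_fun_ltr.
move=> t'; rewrite indicE; have [/set_mem /= /andP[->]//|_ //] := boolP (t' \in C).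
Qed.

End Envelope.

(** * Quantiles and posted prices under a positive density *)

Lemma measurable_fun_ltr_natr {d} {T : measurableType d} {R : realType}
    (a b : T -> R) : measurable_fun setT a -> measurable_fun setT b ->
  measurable_fun setT (fun x => (a x < b x)%R%:R : R).
Proof.
move=> ma mb; apply: (measurableT_comp (f := fun b : bool => b%:R : R)) => //.
exact: measurable_fun_ltr.
Qed.

Section PositiveDensity.
Context {d} {T : measurableType d} {R : realType} {P : probability T R}.
Variables (X : {RV P >-> R}) (f : R -> R).
Hypothesis mf : measurable_fun setT f.
Hypothesis f0 : forall r, 0 <= f r.
Hypothesis fX : forall B : set R, measurable B ->
  distribution P X B = (\int[lebesgue_measure]_(r in B) (f r)%:E)%E.
Hypothesis fpos : forall t t' r, X t < r < X t' -> 0 < f r.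
Notation mu := (@lebesgue_measure R).
Notation F r := (fine (cdf X r)).

Lemma probability_RV_le r : P [set t | X t <= r] = (F r)%:E.
Proof.
by rewrite fineK ?fin_num_measure//; congr (P _).
Qed.

Lemma fine_cdf_homo r s : r <= s -> F r <= F s.
Proof. by move=> rs; rewrite fine_le ?fin_num_measure// cdf_nondecreasing. Qed.

Lemma fine_cdf_ge0 r : 0 <= F r.
Proof. by rewrite fine_ge0. Qed.

Lemma fine_cdf_le1 r : F r <= 1.
Proof. by rewrite -lee_fin fineK ?fin_num_measure// cdf_le1. Qed.

Lemma measurable_RV_set (B : set R) : measurable B -> measurable (X @^-1` B).
Proof. by move=> mB; rewrite -[X in measurable X]setTI; exact: measurable_funP. Qed.

Lemma measurable_RV_le r : measurable [set t | X t <= r].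
Proof.
have -> : [set t | X t <= r] = X @^-1` `]-oo, r].
  by apply/seteqP; split => t; rewrite /= in_itv.
exact: measurable_RV_set.
Qed.

Lemma measurable_RV_lt r : measurable [set t | X t < r].
Proof.
have -> : [set t | X t < r] = X @^-1` `]-oo, r[.
  by apply/seteqP; split => t; rewrite /= in_itv.
exact: measurable_RV_set.
Qed.

Lemma probability_RV_lt r : P [set t | X t < r] = (F r)%:E.
Proof.
rewrite -probability_RV_le; apply/eqP; rewrite eq_le; apply/andP; split.
  apply: le_measure; rewrite ?inE; [exact: measurable_RV_lt|exact: measurable_RV_le|].
  by move=> t /ltW.
have -> : [set t | X t <= r] = [set t | X t < r] `|` X @^-1` [set r].
  apply/seteqP; split => t /=; first by rewrite le_eqVlt => /orP[/eqP->|->]; [right|left].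
  by move=> [/ltW//|->].
apply: le_trans (measureU2 _ (measurable_RV_lt r) (measurable_RV_set (measurable_set1 r))) _.
rewrite [X in (_ + X <= _)%E](_ : _ = 0%E) ?adde0//.
exact: density_atomless fX r.
Qed.

(** If the two levels were equal, [X] would almost surely avoid the interval between the values, and
    the indicator of that interval divided by the density would integrate to 0. By
    [ge0_integral_div_density] and positivity this integral is the length of the interval. *)
Lemma fine_cdf_strict t t' : X t < X t' -> F (X t) < F (X t').
Proof.
move=> tt'; rewrite lt_neqAle fine_cdf_homo ?(ltW tt')// andbT; apply/eqP => FF.
have mI : measurable (`]X t, X t'[%classic : set R) by exact: measurable_itv.
have := @ge0_integral_div_density _ _ _ _ X f mf f0 fX (\1_(`]X t, X t'[))
  (measurable_indic mI) (fun r => ler0n _ _).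
set L := LHS; have -> : L = 0%E.
  rewrite /L (@ae_eq_integral _ _ _ P setT (cst 0%E)) ?integral0//.
    apply/measurable_EFinP; apply: measurable_funM.
      by apply: (measurableT_comp (f := \1_(`]X t, X t'[) : R -> R)).
    apply: measurable_fun_ge0_inv => //.
    exact: measurableT_comp mf _.
  exists (X @^-1` `]X t, X t'[); split; first exact: measurable_RV_set.
    apply/eqP; rewrite -measure_le0.
    apply: (@le_trans _ _ (P ([set z | X z <= X t'] `\` [set z | X z <= X t]))).
      apply: le_measure; rewrite ?inE; first exact: measurable_RV_set.
        by apply: measurableD; exact: measurable_RV_le.
      move=> z /=; rewrite in_itv/= => /andP[h1 h2].
      by rewrite (ltW h2); split => //; apply/negP; rewrite -ltNge.
    rewrite measureD; [|exact: measurable_RV_le..|]; last first.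
      by rewrite ltey_eq fin_num_measure//; exact: measurable_RV_le.
    rewrite setIidr; last by move=> z /= /le_trans; apply; exact: ltW.
    rewrite [X in (X - _ <= _)%E](_ : _ = (F (X t'))%:E); last exact: probability_RV_le.
    rewrite [X in (_ - X <= _)%E](_ : _ = (F (X t))%:E); last exact: probability_RV_le.
    by rewrite -EFinB FF subrr.
  move=> z /= /not_implyP[_]; rewrite indicE.
  by have [/set_mem//|_] := boolP (X z \in _); rewrite mul0r.
have -> : (\int[mu]_(r in [set r | (0 < f r)%R]) (\1_(`]X t, X t'[) r)%:E
    = (X t' - X t)%:E)%E.
  rewrite integral_indic//; last first.
    have -> : [set r | 0 < f r] = f @^-1` `]0, +oo[.
      by apply/seteqP; split => r; rewrite /= in_itv/= andbT.
    by rewrite -[X in measurable X]setTI; exact: mf.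
  rewrite setIidl; last by move=> r /=; rewrite in_itv/= => /fpos.
  transitivity (lebesgue_measure [set` `]X t, X t'[]) => //.
  by rewrite lebesgue_measure_itv/= lte_fin tt' -EFinD.
by move=> -[] /eqP; rewrite eq_sym subr_eq0 gt_eqF.
Qed.

(** Probability integral transform: for [u < 1] and [s] the supremum of the points with cdf at most
    [u], the event is that [X] is at most [s], and [F s = u]. The bound from above uses that there
    are no atoms, the bound from below right continuity. *)
Lemma fine_cdf_uniform (u : R) : 0 <= u <= 1 -> P [set t | F (X t) <= u] = u%:E.
Proof.
move=> /andP[u0 u1].
have [u1'|u1'] := ltP u 1; last first.
  rewrite (_ : [set t | _] = setT) ?probability_setT; last first.
    by apply/seteqP; split => t //= _; exact: le_trans (fine_cdf_le1 _) u1'.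
  by congr (_%:E); apply/eqP; rewrite eq_le u1 u1'.
pose S := [set r | F r <= u].
have [r1 Fr1] : exists r1, u < F r1.
  have /fine_cvgP[_ /cvgr_gt /(_ _ u1') [r1 [_ /(_ (r1 + 1))]]] := cvg_cdfy1 X.
  by rewrite ltrDl ltr01 => /(_ isT) ?; exists (r1 + 1).
have ubS : has_ubound S.
  exists r1 => r Sr; rewrite leNgt; apply/negP => r1r.
  by have := lt_le_trans Fr1 (fine_cdf_homo (ltW r1r)); rewrite ltNge Sr.
(* If [F] exceeds [u] everywhere, its limit 0 at minus infinity forces [u = 0], and the event is
   empty. *)
have [[r0 Sr0]|S0] := pselect (S !=set0); last first.
  have Fu r : u < F r by rewrite ltNge; apply/negP => ?; apply: S0; exists r.
  have u00 : u = 0.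
    apply/eqP; rewrite eq_le u0 andbT leNgt; apply/negP => u0'.
    have /fine_cvgP[_ /cvgr_lt /(_ _ u0') [r2 [_ /(_ (r2 - 1))]]] := cvg_cdfNy0 X.
    rewrite gtrBl ltr01 => /(_ isT) /=.
    by have := Fu (r2 - 1); lra.
  rewrite (_ : [set t | _] = set0) ?measure0 ?u00//.
  by rewrite -subset0 => t /=; rewrite leNgt -u00 Fu.
have hsS : has_sup S by split => //; exists r0.
pose s := sup S.
have Fs : F s = u.
  apply/eqP; rewrite eq_le; apply/andP; split.
    rewrite -lee_fin -probability_RV_lt.
    have -> : [set t | X t < s] = \bigcup_n [set t | X t <= s - n.+1%:R^-1].
      apply/seteqP; split => t /= => [Xs|[n _ /=] /le_lt_trans]; last first.
        by apply; rewrite ltrBlDl ltrDr.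
      have [n] := ltr_add_invr Xs.
      by exists n => //=; rewrite lerBrDr ltW.
    have nd : {homo (fun n => [set t | X t <= s - n.+1%:R^-1]) : n m / (n <= m)%N >-> (n <= m)%O}.
      move=> n m nm; apply/subsetPset => t /= /le_trans; apply.
      by rewrite lerD2l lerN2 lef_pV2 ?posrE// ler_nat.
    have := nondecreasing_cvg_mu (mu := P) (fun n => measurable_RV_le (s - n.+1%:R^-1)) _ nd.
    move=> /(_ (bigcupT_measurable _ (fun n => measurable_RV_le (s - n.+1%:R^-1)))) cv.
    rewrite -(cvg_lim _ cv)//; apply: lime_le; first by apply/cvg_ex; eexists; exact: cv.
    apply: nearW => n /=; rewrite probability_RV_le lee_fin.
    have : s - n.+1%:R^-1 < s by rewrite ltrBlDl ltrDr.
    by move=> /(sup_gt (proj1 hsS))[r Sr /ltW rs]; rewrite (le_trans (fine_cdf_homo rs)).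
  rewrite -lee_fin fineK ?fin_num_measure//.
  have cv := @cdf_right_continuous _ _ _ P X s.
  rewrite -(cvg_lim _ cv)//; apply: lime_ge; first by apply/cvg_ex; eexists; exact: cv.
  near=> r.
  rewrite -[leRHS]fineK ?fin_num_measure// lee_fin leNgt; apply/negP => Fru.
  have : s < r by near: r; exact: nbhs_right_gt.
  by rewrite ltNge sup_upper_bound// /S/= ltW.
rewrite -[in RHS]Fs -probability_RV_le; congr (P _); apply/seteqP; split => t /=.
  by move=> Ft; exact: sup_upper_bound.
by move=> Xs; rewrite -Fs fine_cdf_homo.
Unshelve. all: by end_near. Qed.

(* Both sides are the integral of 1 - F over ]c, +oo[. *)
Lemma monopoly_payment (c : R) :
  (forall r, c < r -> exists t, X t < r) ->
  (\int[P]_t ((X t - c) * (c < X t)%R%:R)%:E <=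
   \int[P]_t ((c < X t)%R%:R * (1 - F (X t)) / f (X t))%:E)%E.
Proof.
move=> hc.
have mF : measurable_fun setT (fun r : R => F r).
  by apply: nondecreasing_measurable => // r s; exact: fine_cdf_homo.
rewrite (@ge0_integral_div_density _ _ _ _ X f mf f0 fX (fun r => (c < r)%R%:R * (1 - F r))); last 2 first.
- apply: measurable_funM; first exact: measurable_fun_ltr_natr.
  exact: measurable_funB.
- by move=> r; rewrite mulr_ge0// subr_ge0 fine_cdf_le1.
have mfp : measurable [set r | 0 < f r].
  have -> : [set r | 0 < f r] = f @^-1` `]0, +oo[.
    by apply/seteqP; split => r; rewrite /= in_itv/= andbT.
  by rewrite -[X in measurable X]setTI; exact: mf.
(* Integrating out [t] gives [1 - F r] for [r > c] of positive density. Integrating out [r] gives at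
   least the length of the interval from [c] to [X t]: by the hypothesis on [c], each of its points
   lies strictly between two values, where the density is positive. *)
pose G (r : measurableTypeR R) (t : T) : R := (0 < f r)%R%:R * ((c < r)%R%:R * (r < X t)%R%:R).
have mG : measurable_fun setT (fun z => G z.1 z.2).
  apply: measurable_funM.
    apply: measurable_fun_ltr_natr; first exact: measurable_cst.
    exact: measurableT_comp mf measurable_fst.
  apply: measurable_funM; apply: measurable_fun_ltr_natr.
  - exact: measurable_cst.
  - exact: measurable_fst.
  - exact: measurable_fst.
  - by apply: measurableT_comp => //; exact: measurable_snd.
have G0 r t : 0 <= G r t by rewrite !mulr_ge0.
rewrite [leRHS](_ : _ = \int[mu]_r \int[P]_t (G r t)%:E)%E; last first.
  rewrite integral_mkcond; apply: eq_integral => r _; rewrite patchE.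
  have [fr|fr] := boolP (0 < f r); last first.
    rewrite memNset; last exact/negP.
    by rewrite integral0_eq// => t _; rewrite /G (negbTE fr) mul0r.
  rewrite mem_set// /G fr; under eq_integral do rewrite mul1r EFinM.
  rewrite ge0_integralZl_EFin//; last first.
    by apply/measurable_EFinP; exact: measurable_fun_ltr_natr.
  rewrite EFinM; congr (_ * _)%E.
  have mlt : measurable [set t | r < X t].
    have -> : [set t | r < X t] = X @^-1` `]r, +oo[.
      by apply/seteqP; split => t; rewrite /= in_itv/= andbT.
    exact: measurable_RV_set.
  rewrite (_ : (fun t => _) = (fun t => (\1_[set t | r < X t] t)%:E)); last first.
    apply/funext => t; rewrite indicE.
    have [rX|/negP rX] := boolP (r < X t); first by rewrite mem_set.
    by rewrite memNset.
  rewrite integral_indic// setIT.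
  have -> : [set t | r < X t] = ~` [set t | X t <= r].
    by apply/seteqP; split => t /=; rewrite ltNge => /negP.
  rewrite EFinB -probability_RV_le; apply/esym/probability_setC.
  exact: measurable_RV_le.
rewrite (exchange_integral_EFin _ P mG)//.
apply: ge0_le_integral => //.
- move=> t _; rewrite lee_fin; case: ltrP => [ct|_]; last by rewrite mulr0.
  by rewrite mulr1 subr_ge0 ltW.
- apply/measurable_EFinP; apply: measurable_funM; first exact: measurable_funB.
  exact: measurable_fun_ltr_natr.
- apply: (@measurable_integral_EFin _ _ _ _ _ mu (fun t r => G r t)) => //.
  exact: (measurableT_comp mG (@measurable_swap _ _ _ _)).
move=> t _; case: ltrP => [ct|_]; last first.
  by rewrite mulr0; apply: integral_ge0 => r _; rewrite lee_fin.
rewrite mulr1.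
have -> : (X t - c)%:E = lebesgue_measure [set` `]c, X t[].
  by rewrite lebesgue_measure_itv/= lte_fin ct -EFinD.
rewrite -[X in lebesgue_measure X]setIT -integral_indic//.
apply: ge0_le_integral_EFin => //.
  exact: (measurable_fun_section (F := fun t r => G r t) _ (measurableT_comp mG (@measurable_swap _ _ _ _))).
move=> r; rewrite indicE; have [/set_mem /=|_] := boolP (r \in _); last exact: G0.
rewrite in_itv/= => /andP[cr rX]; have [t' Xt'] := hc _ cr.
by rewrite /G cr rX (fpos (t := t') (t' := t)) ?Xt'// !mul1r.
Qed.

End PositiveDensity.

(** * The information rent of a single bidder *)

Section InformationRent.
Context {d} {T : measurableType d} {R : realType} {P : probability T R}.
Context {A : finType} (a0 : A) (v : A -> {RV P >-> R}) (f : A -> R -> R).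
Hypothesis mf : forall a, measurable_fun setT (f a).
Hypothesis f0 : forall a r, 0 <= f a r.
Hypothesis fv : forall a (B : set R), measurable B ->
  distribution P (v a) B = (\int[lebesgue_measure]_(r in B) (f a r)%:E)%E.
Hypothesis fpos : forall a t t' r, v a t < r < v a t' -> 0 < f a r.
Hypothesis ordered : forall a a' t t', v a t < v a t' -> v a' t <= v a' t'.
Notation q a t := (fine (cdf (v a) (v a t))).

(* As values have no atoms, the quantile is also the probability of a strictly
   smaller value, which by the common order on types is a weakly smaller value
   in any other state. *)
Lemma quantile_state_free a a' t : q a t = q a' t.
Proof.
suff h b b' : q b t <= q b' t by apply/eqP; rewrite eq_le !h.
rewrite -lee_fin -(probability_RV_lt (fv b)) -probability_RV_le; apply: le_measure; rewrite ?inE.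
- exact: measurable_RV_lt.
- exact: measurable_RV_le.
- by move=> t' /=; exact: ordered.
Qed.

Lemma quantile_mono a a' t t' : q a t <= q a t' -> v a' t <= v a' t'.
Proof.
rewrite (quantile_state_free a a') (quantile_state_free a a') leNgt => h; rewrite leNgt; apply: contra h.
exact: fine_cdf_strict (mf a') (f0 a') (fv a') (@fpos a') _ _.
Qed.

(** The envelope inequality for the rent [U], the quantile being read in the state [a0]. With
    payment plus virtual rent on the left and value on the right, no possibly infinite integral is
    subtracted. *)
Lemma information_rent (y : A -> T -> R) (p : T -> R) :
  (forall a, measurable_fun setT (y a)) -> measurable_fun setT p ->
  (forall a t, 0 <= y a t) -> (forall t, 0 <= p t) ->
  (forall t, p t <= \sum_a y a t * v a t) ->
  (forall t t', \sum_a y a t * v a t' - p t <= \sum_a y a t' * v a t' - p t') ->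
  (\int[P]_t (p t)%:E +
   \int[P]_t (\sum_a y a t * ((1 - q a t) / f a (v a t)))%:E <=
   \int[P]_t (\sum_a y a t * v a t)%:E)%E.
Proof.
move=> my mp y0 p0 IR IC.
pose U t := \sum_a y a t * v a t - p t.
have mv a : measurable_fun setT (v a) by exact: measurable_funPT.
have mS : measurable_fun setT (fun t => \sum_a y a t * v a t).
  by apply: measurable_sum => a; exact: measurable_funM.
have mU : measurable_fun setT U by exact: measurable_funB.
have U0 t : 0 <= U t by rewrite subr_ge0.
have mq a : measurable_fun setT (fun t => q a t).
  apply: (measurableT_comp (f := fun r : R => fine (cdf (v a) r))) => //.
  by apply: nondecreasing_measurable => // r s; exact: fine_cdf_homo.
have q0 a t : 0 <= q a t by exact: fine_cdf_ge0.
have q1 a t : q a t <= 1 by exact: fine_cdf_le1.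
have -> : (\int[P]_t (\sum_a y a t * v a t)%:E =
    \int[P]_t (p t)%:E + \int[P]_t (U t)%:E)%E.
  rewrite -ge0_integralD//.
  - by apply: eq_integral => t _; rewrite -EFinD /U; congr (_%:E); ring.
  - by move=> t _; rewrite lee_fin.
  - exact/measurable_EFinP.
  - by move=> t _; rewrite lee_fin.
  - exact/measurable_EFinP.
apply: leeD2l.
have := @envelope_rent _ _ _ P A (fun t => q a0 t) U y v (fun a t => f a (v a t)).
under eq_integral => t _.
  rewrite mulr_sumr; under eq_bigr => a _ do rewrite mulrCA (quantile_state_free a0 a).
  over.
apply => //.
- move=> a; exact: measurableT_comp (mf a) (mv a).
- by move=> u; exact: (fine_cdf_uniform (fv a0)).
- by move=> a t t'; exact: quantile_mono.
- apply: filter_forall => a.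
  have H1 := ae_density_gt0 (mf a) (f0 a) (fv a).
  have H2 := ae_cdf_slope (mf a) (f0 a) (fv a).
  move: H1 H2; apply: filterS2 => t ft slope; split=> // e e0.
  have fe0 : 0 < f a (v a t) + e by rewrite addr_gt0.
  have [eta eta0 H] := slope e e0.
  (* Beyond distance [eta] in value, [f + e] times the value increment already exceeds this quantile
     range, so the local slope bound is needed only within [eta]. *)
  exists (eta * (f a (v a t) + e)); first by rewrite mulr_gt0.
  move=> t' /andP[qt qt']; have vtt' := quantile_mono a (ltW qt).
  have [h|h] := ltrP (v a t') (v a t + eta).
    by rewrite !(quantile_state_free a0 a) H// vtt'.
  apply: (@le_trans _ _ (eta * (f a (v a t) + e))); first lra.
  by rewrite mulrC ler_wpM2l ?(ltW fe0)//; lra.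
- move=> t t'; rewrite /U.
  have H := IC t t'; under [X in _ + X <= _]eq_bigr do rewrite mulrBr.
  by rewrite sumrB; lra.
Qed.
End InformationRent.

(** * Product beliefs and Myerson's auction *)

Section FiniteProduct.
Context {R : realType} {n : nat} {Th : 'I_n -> finPointedType}.
Local Notation states := {dffun forall i, Th i}.
Local Notation S := (@signal R n Th).
Implicit Types (s : profile S) (th : states).

Lemma regulated_belief_ge0 s th : 0 <= regulated_belief s th.
Proof. by apply: prodr_ge0 => i _; exact: mass_ge0. Qed.

(** Expand the product of the total masses by distributivity; the passage through tagged values and
    [fprod] turns the resulting index into dependent state profiles. *)
Lemma regulated_belief_sum1 s : \sum_(th : states) regulated_belief s th = 1.
Proof.
pose P_ i : {ffun Th i -> R} := [ffun a => s i a].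
transitivity (\prod_(i < n) \sum_(a : Th i) s i a); last first.
  by rewrite big1// => i _; exact: mass_sum1.
under [RHS]eq_bigr => i _.
  rewrite (eq_bigr (P_ i)); last by move=> a _; rewrite ffunE.
  rewrite (big_tag (T_ := fun i => Th i : finType) (fun i => P_ i : Th i -> R) i); over.
rewrite bigA_distr_big_dep/=.
have -> : \sum_(f in family (fun i => [in tagged_with (fun i => Th i : finType) i]))
     \prod_(i < n) untag 0 (P_ i : Th i -> R) (f i) =
   \sum_(t : fprod (fun i => Th i : finType)) \prod_(i in 'I_n) P_ i (t i).
  by rewrite (@big_fprod R 0 1 *%R +%R 'I_n (fun i => Th i : finType) P_).
rewrite (reindex (@dffun_of_fprod _ (fun i => Th i : finType))); last first.
  exact/onW_bij/dffun_of_fprod_bij.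
apply: eq_bigr => t _; apply: eq_bigr => i _.
by rewrite !ffunE.
Qed.

(** [dfwith] repackaged as a finite function, so that the updated profile is again an index of sums
    over [states]. *)
Definition upd_state th i (a : Th i) : states := [ffun j => dfwith th i a j].

Lemma upd_stateE th i (a : Th i) j : upd_state th a j = dfwith th i a j.
Proof. by rewrite ffunE. Qed.

Lemma upd_state_in th i (a : Th i) : upd_state th a i = a.
Proof. by rewrite ffunE dfwithin. Qed.

Lemma upd_state_out th i (a : Th i) j : i != j -> upd_state th a j = th j.
Proof. by move=> ij; rewrite ffunE dfwithout. Qed.

Lemma upd_stateK th i (a : Th i) : upd_state (upd_state th a) (th i) = th.
Proof.
apply/ffunP => j; have [<-|ij] := eqVneq i j; first by rewrite upd_state_in.
by rewrite !upd_state_out.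
Qed.

Lemma regulated_belief_upd s th i (a : Th i) :
  regulated_belief s (upd_state th a) * s i (th i) = regulated_belief s th * s i a.
Proof.
rewrite /regulated_belief (bigD1 i)//= [in RHS](bigD1 i)//= upd_state_in.
rewrite (eq_bigr (fun j => s j (th j))); first by ring.
by move=> j ji; rewrite upd_state_out// eq_sym.
Qed.

(** Under a product belief, redrawing coordinate [i] from [s i] changes nothing: exchanging the old
    and the new coordinate is an involution that preserves the joint weights. *)
Lemma regulated_belief_resample s i (phi : states -> R) :
  \sum_(th : states) regulated_belief s th * phi th =
  \sum_(th : states) regulated_belief s th * \sum_a s i a * phi (upd_state th a).
Proof.
transitivity (\sum_(th : states) \sum_a regulated_belief s th * s i a * phi th).
  apply: eq_bigr => th _; rewrite -mulr_suml -mulr_sumr.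
  by rewrite mass_sum1 mulr1.
under [RHS]eq_bigr do rewrite mulr_sumr.
rewrite !pair_big /=.
rewrite (reindex (fun p : states * Th i => (upd_state p.1 p.2, p.1 i)))/=.
  by apply: eq_bigr => -[th a] _/=; rewrite regulated_belief_upd mulrA.
exists (fun p : states * Th i => (upd_state p.1 p.2, p.1 i)) => -[th a] _ /=;
  by rewrite upd_stateK upd_state_in.
Qed.

Lemma regulated_belief_marginal s i (phi : Th i -> R) :
  \sum_(th : states) regulated_belief s th * phi (th i) = mean (s i) phi.
Proof.
rewrite (regulated_belief_resample s i (fun th => phi (th i))).
under eq_bigr => th _ do under eq_bigr => a _ do rewrite upd_state_in.
by rewrite -mulr_suml regulated_belief_sum1 mul1r.
Qed.

End FiniteProduct.

(** Twice the covariance is the mean of [(X a - X b) * (V a - V b)] over two independent draws from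
    [s]. *)
Lemma chebyshev_sum_le (R : realType) (A : finType) (s : dist R A) (X V : A -> R) :
  (forall a b, 0 <= (X a - X b) * (V a - V b)) ->
  mean s X * mean s V <= mean s (fun a => X a * V a).
Proof.
move=> XV.
have : 0 <= \sum_a \sum_b s a * s b * ((X a - X b) * (V a - V b)).
  by apply: sumr_ge0 => a _; apply: sumr_ge0 => b _; rewrite mulr_ge0// mulr_ge0// mass_ge0.
suff -> : \sum_a \sum_b s a * s b * ((X a - X b) * (V a - V b)) =
    (mean s (fun a => X a * V a) - mean s X * mean s V) *+ 2.
  by rewrite pmulrn_lge0// subr_ge0.
transitivity (\sum_a \sum_b (s b * (s a * (X a * V a)) + s a * (s b * (X b * V b))
   - (s a * X a) * (s b * V b) - (s a * V a) * (s b * X b))).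
  by apply: eq_bigr => a _; apply: eq_bigr => b _; ring.
under eq_bigr => a _.
  rewrite !(sumrB, big_split)/= -mulr_suml mass_sum1 mul1r -!mulr_sumr.
  over.
rewrite !(sumrB, big_split)/= -!mulr_suml mass_sum1 mul1r /mean.
by rewrite mulr2n [X in _ - X = _]mulrC; ring.
Qed.

(** Where [s] has mass, [X] equals its mean and factors out. *)
Lemma variance0_mean (R : realType) (A : finType) (s : dist R A) (X V : A -> R) :
  Defs.variance s X = 0 -> mean s X * mean s V = mean s (fun a => X a * V a).
Proof.
move=> /eqP; rewrite /Defs.variance {1}/mean psumr_eq0; last first.
  by move=> a _; rewrite mulr_ge0 ?mass_ge0// sqr_ge0.
move=> /allP H; rewrite {2 3}/mean mulr_sumr; apply: eq_bigr => a _.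
have := H a (mem_index_enum a); rewrite /= mulf_eq0 sqrf_eq0 subr_eq0.
by move=> /orP[] /eqP ->; [rewrite !mul0r mulr0|ring].
Qed.

Section Myerson.
Context {R : realType} {n : nat} {d : measure_display}.
Context {T : 'I_n -> measurableType d} {h : forall i, probability (T i) R}.
Context {Th : 'I_n -> finPointedType}.
Variable v : forall i, Th i -> {RV (h i) >-> R}.
Arguments v : clear implicits.
Variable f : forall i, Th i -> R -> R.
Arguments f : clear implicits.
Hypothesis f_ge0 : forall i a r, 0 <= f i a r.
Implicit Types (b : profile T) (th : forall i, Th i).

Notation z b th i := (\big[Num.max/0]_(j < n | j != i) phi v f (th j) (b j)).
Notation c b th i := (critical_value v f (th i) (z b th i)).
Notation x b th i := (base_alloc v f b th i).

Lemma value_cdf_le1 i (a : Th i) r : value_cdf v a r <= 1.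
Proof. by rewrite -lee_fin fineK ?fin_num_measure// cdf_le1. Qed.

Lemma phi_le_value i (a : Th i) (t : T i) : phi v f a t <= v i a t.
Proof. by rewrite gerBl divr_ge0// subr_ge0 value_cdf_le1. Qed.

Lemma threshold_ge0 b th i : 0 <= z b th i.
Proof. exact: bigmax_ge_id. Qed.

Lemma phi_le_threshold b th i j : j != i -> phi v f (th j) (b j) <= z b th i.
Proof. by move=> ji; rewrite (bigD1 j)//= le_max lexx. Qed.

Lemma critical_lbound i (a : Th i) (u : R) : 0 <= u ->
  lbound [set v i a t | t in [set t : T i | u <= phi v f a t]] 0.
Proof. by move=> u0 _ [t /= ut <-]; rewrite (le_trans u0)// (le_trans ut) ?phi_le_value. Qed.

Lemma critical_le i (a : Th i) (u : R) (t : T i) : 0 <= u -> u <= phi v f a t ->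
  critical_value v f a u <= v i a t.
Proof.
move=> u0 ut; apply: ge_inf; last by exists t.
by exists 0; exact: critical_lbound.
Qed.

Lemma le_critical i (a : Th i) (u r : R) (t0 : T i) : u <= phi v f a t0 ->
  (forall t, u <= phi v f a t -> r <= v i a t) -> r <= critical_value v f a u.
Proof.
move=> ut0 H; apply: lb_le_inf; first by exists (v i a t0), t0.
by move=> _ [t /= ut <-]; exact: H.
Qed.

Lemma critical_ge0 i (a : Th i) (u : R) : 0 <= u -> 0 <= critical_value v f a u.
Proof.
move=> u0; have [[t ut]|no] := pselect (exists t, u <= phi v f a t).
  by apply: (le_critical ut) => t' ut'; apply: (critical_lbound (a := a) u0); exists t'.
(* No type reaches the level [u], and the infimum of the empty set is 0 by convention. *)
rewrite /critical_value (_ : [set _ | _ in _] = set0) ?inf0//.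
by rewrite -subset0 => _ [t /= ut _]; apply: no; exists t.
Qed.

Lemma base_alloc_ge0 b th i : 0 <= x b th i.
Proof. exact: ler0n. Qed.

Lemma base_alloc_eq0 b th i : x b th i != 1 -> x b th i = 0.
Proof. by rewrite /base_alloc /myerson_alloc; case: (_ && _) => //; rewrite eqxx. Qed.

Lemma base_alloc_phi b th i : x b th i != 0 ->
  0 < phi v f (th i) (b i) /\ z b th i <= phi v f (th i) (b i).
Proof.
rewrite /base_alloc /myerson_alloc pnatr_eq0 eqb0 negbK => /andP[p0 /forallP H].
split => //; apply: (big_ind (fun u => u <= _)) => [|u w uz wz|j ji]; first exact: ltW.
  by rewrite ge_max uz wz.
have := H j; rewrite ji/=; case: ifP => // _; exact: ltW.
Qed.

Lemma phi_base_alloc b th i : z b th i < phi v f (th i) (b i) -> x b th i = 1.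
Proof.
move=> zp; rewrite /base_alloc /myerson_alloc.
rewrite [0 < _](le_lt_trans (threshold_ge0 b th i) zp)/=.
suff -> : [forall j : 'I_n, (j != i) ==>
      if (i < j)%N then virtual v f (th j) (v j (th j) (b j)) <= virtual v f (th i) (v i (th i) (b i))
      else virtual v f (th j) (v j (th j) (b j)) < virtual v f (th i) (v i (th i) (b i))] by [].
apply/forallP => j; apply/implyP => ji.
have := le_lt_trans (phi_le_threshold b th ji) zp.
by case: ifP => // _ /ltW.
Qed.

Lemma base_alloc_homo b b' th th' i : (forall j, j != i -> b j = b' j) ->
  (forall j, j != i -> th j = th' j) ->
  phi v f (th i) (b i) <= phi v f (th' i) (b' i) -> x b th i <= x b' th' i.
Proof.
move=> bb' tt' pp'; have [->|] := eqVneq (x b th i) 0; first exact: base_alloc_ge0.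
rewrite /base_alloc /myerson_alloc pnatr_eq0 eqb0 negbK => /andP[p0 /forallP H].
rewrite p0 (introT forallP H) [0 < _](lt_le_trans p0 pp')/= ler1n lt0b.
apply/forallP => j; apply/implyP => ji; have := H j; rewrite ji/= -tt'// -bb'//.
by case: ifP => _ lij; [exact: le_trans lij pp'|exact: lt_le_trans lij pp'].
Qed.

(** Two winners would each have to beat the other, one of the two comparisons being strict by the
    tie-breaking on indices. *)
Lemma sum_base_alloc_le1 b th : \sum_(i < n) x b th i <= 1.
Proof.
have [/existsP[i xi]|/existsPn no] := boolP [exists i, x b th i != 0]; last first.
  by rewrite big1// => i _; have := no i; rewrite negbK => /eqP.
rewrite (bigD1 i)//= big1 ?addr0; first by rewrite /base_alloc /myerson_alloc lern1 leq_b1.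
move=> j ji; apply/eqP/negPn/negP => xj.
move: xi xj; rewrite /base_alloc /myerson_alloc !pnatr_eq0 !eqb0 !negbK.
move=> /andP[_ /forallP/(_ j)] + /andP[_ /forallP/(_ i)].
have nij : i != j by rewrite eq_sym.
rewrite ji nij/=.
have [ij|ij|/val_inj ij] := ltngtP i j.
- by move=> h1 h2; have := le_lt_trans h1 h2; rewrite ltxx.
- by move=> h1 h2; have := lt_le_trans h1 h2; rewrite ltxx.
- by rewrite ij eqxx in ji.
Qed.

Lemma base_payE b th i : base_pay v f b th i = x b th i * c b th i.
Proof. by []. Qed.

Lemma base_pay_ge0 b th i : 0 <= base_pay v f b th i.
Proof. by rewrite mulr_ge0 ?base_alloc_ge0// critical_ge0// threshold_ge0. Qed.

Lemma base_utility_ge0 b th i : 0 <= x b th i * (v i (th i) (b i) - c b th i).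
Proof.
have [->|/base_alloc_phi[_ zp]] := eqVneq (x b th i) 0; first by rewrite mul0r.
by rewrite mulr_ge0 ?base_alloc_ge0// subr_ge0 critical_le// threshold_ge0.
Qed.

Lemma upd_type_in b i (t : T i) : upd_type b t i = t.
Proof. exact: dfwithin. Qed.

Lemma upd_type_out b i (t : T i) j : j != i -> upd_type b t j = b j.
Proof. by move=> ji; rewrite /upd_type dfwithout// eq_sym. Qed.

Lemma threshold_upd b b' th th' i : (forall j, j != i -> b j = b' j) ->
  (forall j, j != i -> th j = th' j) -> z b th i = z b' th' i.
Proof. by move=> bb' tt'; apply: eq_bigr => j ji; rewrite bb'// tt'. Qed.

Hypothesis phi_regular : regular_virtual_values v f.

(** The price depends only on the others. If the report wins and the truth loses, the price is at
    least the true value: a cheaper type reaching the threshold would, by regularity, put [t]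
    strictly above it. *)
Lemma base_DSIC b th i (t : T i) :
  x b th i * v i (th i) t - base_pay v f b th i <=
  x (upd_type b t) th i * v i (th i) t - base_pay v f (upd_type b t) th i.
Proof.
rewrite !base_payE -!mulrBr.
have zE : z (upd_type b t) th i = z b th i.
  by apply: threshold_upd => // j ji; rewrite upd_type_out.
have := base_utility_ge0 (upd_type b t) th i.
rewrite upd_type_in zE.
have [->|/base_alloc_phi[p0 zp]] := eqVneq (x b th i) 0; first by rewrite mul0r.
have [x1|x1 _] := eqVneq (x (upd_type b t) th i) 1.
  by rewrite x1 mul1r => vc; rewrite ler_piMl// /base_alloc /myerson_alloc lern1 leq_b1.
rewrite (base_alloc_eq0 x1) mul0r mulr_ge0_le0 ?base_alloc_ge0// subr_le0.
apply: (le_critical zp) => t' zt'.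
rewrite leNgt; apply/negP => tt'.
move: x1; rewrite phi_base_alloc ?eqxx// zE upd_type_in (le_lt_trans zt')//.
rewrite ltNge; apply/negP => /(phi_regular (th i) (th i) t' t).
by rewrite leNgt tt'.
Qed.

End Myerson.

(** * Measurability of beliefs and profiles *)

Lemma measurable_mass {R : realType} {A : finPointedType} (a : A) :
  measurable_fun setT (fun s : dist R A => s a : R).
Proof.
move=> _ B mB; rewrite setTI.
by apply: sub_sigma_algebra; exists a, B.
Qed.

Lemma measurable_proj_profile {d n} {X : 'I_n -> measurableType d} (i : 'I_n) :
  measurable_fun setT (fun x : profile X => x i).
Proof.
move=> _ B mB; rewrite setTI.
by apply: sub_sigma_algebra; exists i, B.
Qed.

Lemma measurable_profile {d d' n} {V : measurableType d'}
    {X : 'I_n -> measurableType d} (F : V -> profile X) :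
  (forall i, measurable_fun setT (fun x => F x i)) -> measurable_fun setT F.
Proof.
move=> mF.
apply: (@measurability _ _ V (profile X) setT F (@cylinders d n X)) => //.
by move=> _ [_ [i [B mB ->]] <-]; exact: mF.
Qed.

Lemma measurable_dfwith {d d' n} {V : measurableType d'}
    {X : 'I_n -> measurableType d} i (F : V -> profile X) (G : V -> X i) :
  measurable_fun setT F -> measurable_fun setT G ->
  measurable_fun setT (fun x => dfwith (F x : forall j, X j) i (G x) : profile X).
Proof.
move=> mF mG; apply: measurable_profile => j.
have [<-|ij] := eqVneq i j.
  by under eq_fun do rewrite dfwithin.
under eq_fun do rewrite dfwithout//.
apply: (measurableT_comp (f := fun y : profile X => y j)) => //.
exact: measurable_proj_profile.
Qed.

Lemma bounded_integrable {d} {T : measurableType d} {R : realType}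
    (P : probability T R) (F : T -> \bar R) (M : R) :
  measurable_fun setT F -> (forall t, `|F t| <= M%:E)%E -> P.-integrable setT F.
Proof.
move=> mF FM; apply/integrableP; split => //.
apply: (@le_lt_trans _ _ (\int[P]_t M%:E)%E); last first.
  by rewrite integral_cst//= probability_setT mule1 ltry.
apply: ge0_le_integral => //.
exact: measurableT_comp.
Qed.

Lemma measurableT_proj {d d' d'' n} {V : measurableType d'}
    {W : measurableType d''} {X : 'I_n -> measurableType d} (F : V -> profile X)
    i (G : X i -> W) :
  measurable_fun setT F -> measurable_fun setT G ->
  measurable_fun setT (fun x => G (F x i)).
Proof.
move=> mF mG; apply: (measurableT_comp mG).
apply: (measurableT_comp (f := fun y : profile X => y i)) => //.
exact: measurable_proj_profile.
Qed.

(** * The auction simulated on product beliefs *)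

Section SMA.
Context {R : realType} {n : nat} {d : measure_display}.
Context {T : 'I_n -> measurableType d} {h : forall i, probability (T i) R}.
Context {Th : 'I_n -> finPointedType}.
Variable v : forall i, Th i -> {RV (h i) >-> R}.
Arguments v : clear implicits.
Variable f : forall i, Th i -> R -> R.
Arguments f : clear implicits.
Local Notation S := (@signal R n Th).
Local Notation states := {dffun forall i, Th i}.
Hypothesis mf : forall i a, measurable_fun setT (f i a).
Hypothesis f_ge0 : forall i a r, 0 <= f i a r.
Hypothesis phi_regular : regular_virtual_values v f.
Hypothesis v_regular : regular_values v.
Notation SMA := (simulated_myerson v f (@regulated_belief R n Th)).
Notation x b th i := (base_alloc v f b th i).
Notation p b th i := (base_pay v f b th i).
Implicit Types (b : profile T) (s : profile S).

Lemma measurable_virtual i (a : Th i) : measurable_fun setT (virtual v f a).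
Proof.
apply: measurable_funB => //; apply: measurable_funM; last first.
  exact: measurable_fun_ge0_inv.
apply: measurable_funB => //.
by apply: nondecreasing_measurable => // r s; exact: fine_cdf_homo.
Qed.

Lemma measurable_phi i (a : Th i) : measurable_fun setT (fun b => phi v f a (b i)).
Proof.
apply: (measurableT_proj (F := idfun) (G := phi v f a)); first exact: measurable_id.
by apply: (measurableT_comp (f := virtual v f a)) => //; exact: measurable_virtual.
Qed.

Lemma measurable_regulated_belief (th : forall i, Th i) :
  measurable_fun setT (fun s => \prod_(i < n) s i (th i)).
Proof.
apply: measurable_prod => i _.
apply: (measurableT_proj (F := idfun) (G := fun r : S i => r (th i))); first exact: measurable_id.
exact: measurable_mass.
Qed.

Lemma natr_forall (I : finType) (Q : I -> bool) :
  [forall i, Q i]%:R = \prod_i (Q i)%:R :> R.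
Proof.
have [/forallP H|/forallPn[i Qi]] := boolP [forall i, Q i].
  by rewrite big1// => i _; rewrite H.
by rewrite (bigD1 i)//= (negbTE Qi) mul0r.
Qed.

Lemma measurable_base_alloc th i : measurable_fun setT (fun b => x b th i).
Proof.
rewrite /base_alloc /myerson_alloc.
under eq_fun do rewrite -mulnb natrM natr_forall.
apply: measurable_funM.
  by apply: measurable_fun_ltr_natr => //; exact: measurable_phi.
apply: measurable_prod => j _; case: eqVneq => [_|ji] /=.
  exact: measurable_cst.
apply: (measurableT_comp (f := fun b : bool => b%:R : R)) => //.
by case: (i < j)%N; [apply: measurable_fun_ler|apply: measurable_fun_ltr];
  exact: measurable_phi.
Qed.

Lemma measurable_threshold (th : forall i, Th i) i : measurable_fun setT
  (fun b => \big[Num.max/0]_(j < n | j != i) phi v f (th j) (b j)).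
Proof.
elim: (index_enum _) => [|j r IH].
  under eq_fun do rewrite big_nil.
  exact: measurable_cst.
under eq_fun do rewrite big_cons.
by case: (j != i) => //; apply: measurable_maxr => //; exact: measurable_phi.
Qed.

(** The critical value increases with the level as long as some type reaches it, and drops to the
    default 0 afterwards. So it is not monotone, but its superlevel sets at positive heights are
    still intervals. The maximum with 0 keeps it nonnegative. *)
Lemma measurable_critical i (a : Th i) :
  measurable_fun setT (fun u : R => critical_value v f a (Num.max 0 u)).
Proof.
pose D := [set u : R | exists t, Num.max 0 u <= phi v f a t].
have mD : measurable D.
  apply: is_interval_measurable => u w [t tu] [t' tw] r /andP[ur rw].
  by exists t'; apply: le_trans tw; rewrite le_max2.
have cD u : ~ D u -> critical_value v f a (Num.max 0 u) = 0.
  move=> Du; rewrite /critical_value (_ : [set _ | _ in _] = set0) ?inf0//.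
  by rewrite -subset0 => _ [t /= ut _]; apply: Du; exists t.
have chomo u w : D w -> u <= w -> critical_value v f a (Num.max 0 u) <= critical_value v f a (Num.max 0 w).
  move=> [t0 wt0] uw; apply: (le_critical wt0) => t wt; apply: critical_le => //.
    by rewrite le_max lexx.
  by apply: le_trans wt; rewrite le_max2.
suff : @measurable_fun _ _ (measurableTypeR R) (measurableTypeR R) setT
    (fun u : R => critical_value v f a (Num.max 0 u)) by [].
apply: (measurability (@RGenCInfty.G R)) => [|/= _ [_] [r] -> <-].
  exact: RGenCInfty.measurableE.
rewrite setTI; have [r0|r0] := lerP r 0.
  rewrite (_ : _ @^-1` _ = setT)//; apply/seteqP; split => // u _ /=.
  by rewrite in_itv/= andbT (le_trans r0)// critical_ge0// le_max lexx.
apply: is_interval_measurable => u w /=.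
rewrite !in_itv/= !andbT => ru rw z /andP[uz zw]; rewrite in_itv/= andbT.
apply: le_trans ru _; apply: chomo => //.
have [//|/cD Dw] := pselect (D w).
  by case=> t wt; exists t; apply: le_trans wt; rewrite le_max2.
by move: rw; rewrite Dw leNgt r0.
Qed.

Lemma measurable_base_pay th i : measurable_fun setT (fun b => p b th i).
Proof.
apply: measurable_funM; first exact: measurable_base_alloc.
rewrite (_ : (fun b => _) = (fun u : R => critical_value v f (th i) (Num.max 0 u)) \o
    (fun b => \big[Num.max/0]_(j < n | j != i) phi v f (th j) (b j))); last first.
  by apply/funext => b /=; rewrite max_r// threshold_ge0.
exact: measurableT_comp (measurable_critical _) (measurable_threshold _ _).
Qed.

Lemma SMA_is_mechanism : is_mechanism SMA.
Proof.
split.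
- by move=> i b s; apply: sumr_ge0 => th _; rewrite mulr_ge0 ?regulated_belief_ge0 ?base_alloc_ge0.
- by move=> i b s; apply: sumr_ge0 => th _; rewrite mulr_ge0 ?regulated_belief_ge0 ?base_pay_ge0.
- move=> b s; rewrite exchange_big/= -(regulated_belief_sum1 s).
  apply: ler_sum => th _; rewrite -mulr_sumr ler_piMr ?regulated_belief_ge0//.
  exact: sum_base_alloc_le1.
- move=> i; apply: measurable_sum => th; apply: measurable_funM.
    exact: measurableT_comp (measurable_regulated_belief _) measurable_snd.
  exact: measurableT_comp (measurable_base_alloc _ _) measurable_fst.
- move=> i; apply: measurable_sum => th; apply: measurable_funM.
    exact: measurableT_comp (measurable_regulated_belief _) measurable_snd.
  exact: measurableT_comp (measurable_base_pay _ _) measurable_fst.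
Qed.

Notation W := (@regulated_belief R n Th).

(** Regular values carry the order of the states from the true type [t] to the reported type [b i],
    and regular virtual values carry it on to the quantity that decides the winner. *)
Lemma base_alloc_comonotone b (th : states) i (t : T i) (a a' : Th i) :
  0 <= (x b (upd_state th a) i - x b (upd_state th a') i) * (v i a t - v i a' t).
Proof.
suff H (e e' : Th i) : v i e' t <= v i e t -> x b (upd_state th e') i <= x b (upd_state th e) i.
  have [ee'|/ltW ee'] := lerP (v i a' t) (v i a t).
    by rewrite mulr_ge0// subr_ge0// H.
  by rewrite mulr_le0// subr_le0// H.
move=> /(v_regular _ _ t (b i)) /phi_regular pp; apply: base_alloc_homo => //.
  by move=> j ji; rewrite !upd_state_out// eq_sym.
by rewrite !upd_state_in.
Qed.

Lemma SMA_utilityE b s i (t : T i) :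
  utility (own_value v) SMA t b s =
  \sum_(th : states) W s th *
    (mean (s i) (fun a => x b (upd_state th a) i) * mean (s i) (v i ^~ t)) -
  \sum_(th : states) W s th * p b th i.
Proof.
rewrite /utility /own_value /=; congr (_ - _).
rewrite (regulated_belief_resample s i (fun th => x b th i)) mulr_suml.
by apply: eq_bigr => th _; rewrite mulrA.
Qed.

Lemma base_utilityE b s i (t : T i) :
  \sum_(th : states) W s th * (x b th i * v i (th i) t - p b th i) =
  \sum_(th : states) W s th * mean (s i) (fun a => x b (upd_state th a) i * v i a t) -
  \sum_(th : states) W s th * p b th i.
Proof.
under eq_bigr do rewrite mulrBr.
rewrite sumrB; congr (_ - _).
rewrite (regulated_belief_resample s i (fun th => x b th i * v i (th i) t)).
apply: eq_bigr => th _; congr (_ * _); apply: eq_bigr => a _.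
by rewrite upd_state_in.
Qed.

(** The auction multiplies mean allocation and mean value in the own state, while the right side
    takes the mean of the product. The gap is a covariance, nonnegative by comonotonicity. Unlike
    the utility, the right side is linear in [s i]. *)
Lemma SMA_utility_le b s i (t : T i) : utility (own_value v) SMA t b s <=
  \sum_(th : states) W s th * (x b th i * v i (th i) t - p b th i).
Proof.
rewrite SMA_utilityE base_utilityE lerD2r; apply: ler_sum => th _.
rewrite ler_wpM2l ?regulated_belief_ge0//; apply: chebyshev_sum_le => a a'.
exact: base_alloc_comonotone.
Qed.

Lemma SMA_utility_sufficient b s i (t : T i) :
  (forall th : states, Defs.variance (s i) (fun a => x b (dfwith th i a) i) = 0) ->
  utility (own_value v) SMA t b s =
  \sum_(th : states) W s th * (x b th i * v i (th i) t - p b th i).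
Proof.
move=> var0; rewrite SMA_utilityE base_utilityE; congr (_ - _).
apply: eq_bigr => th _; congr (_ * _); apply: variance0_mean.
rewrite -[RHS](var0 th); congr Defs.variance; apply/funext => a.
rewrite (_ : (upd_state th a : forall j, Th j) = dfwith th i a)//.
by apply: functional_extensionality_dep => j; rewrite upd_stateE.
Qed.

(** On the supports the covariance gap vanishes, so the utility is a mean of state-wise utilities of
    truthful bidders in Myerson's auction. *)
Lemma SMA_ex_post_IR (tau : forall i, probability (S i) R) :
  information_sufficiency v f tau -> ex_post_IR tau (own_value v) SMA.
Proof.
move=> suff_tau i t s supp_s.
rewrite SMA_utility_sufficient; last by move=> th; exact: suff_tau.
apply: sumr_ge0 => th _; rewrite mulr_ge0 ?regulated_belief_ge0//.
by rewrite base_payE -mulrBr base_utility_ge0.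
Qed.

Definition belief_others s i (th : states) : R := \prod_(j < n | j != i) s j (th j).

Lemma upd_signal_in s i (r : S i) : upd_signal s r i = r.
Proof. exact: dfwithin. Qed.

Lemma regulated_belief_upd_signal s i (r : S i) (th : states) :
  W (upd_signal s r) th = belief_others s i th * r (th i).
Proof.
rewrite /regulated_belief (bigD1 i)//= upd_signal_in mulrC; congr (_ * _).
by apply: eq_bigr => j ji; rewrite /upd_signal dfwithout// eq_sym.
Qed.

Lemma dist_le1 (A : finType) (r : dist R A) a : r a <= 1.
Proof.
rewrite -(mass_sum1 r) (bigD1 a)//= lerDl; apply: sumr_ge0 => e _.
exact: mass_ge0.
Qed.

Lemma mean_bound (A : finType) (r : dist R A) (F : A -> R) :
  `|mean r F| <= \sum_a `|F a|.
Proof.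
apply: le_trans (ler_norm_sum _ _ _) _; apply: ler_sum => a _.
by rewrite normrM (ger0_norm (mass_ge0 r a)) ler_piMl// dist_le1.
Qed.

Lemma regulated_belief_le1 s th : W s th <= 1.
Proof.
rewrite -(regulated_belief_sum1 s) (bigD1 th)//= lerDl; apply: sumr_ge0 => e _.
exact: regulated_belief_ge0.
Qed.

Lemma SMA_utility_bound b i (t : T i) : exists M : R,
  0 <= M /\ forall s, `|utility (own_value v) SMA t b s| <= M.
Proof.
exists (\sum_a `|v i a t| + \sum_(th : states) p b th i); split.
  rewrite addr_ge0//; first exact: sumr_ge0.
  by apply: sumr_ge0 => th _; exact: base_pay_ge0.
move=> s; rewrite /utility; apply: le_trans (ler_normB _ _) _; apply: lerD.
  rewrite normrM; apply: le_trans (mean_bound (s i) (v i ^~ t)).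
  have [_ _ h1 _ _] := SMA_is_mechanism.
  have [h0 _ _ _ _] := SMA_is_mechanism.
  rewrite ler_piMl// ger0_norm ?h0//.
  apply: le_trans (h1 b s); rewrite (bigD1 i)//= lerDl; apply: sumr_ge0 => j _.
  exact: h0.
rewrite ger0_norm; last by have [_ h0 _ _ _] := SMA_is_mechanism; exact: h0.
apply: ler_sum => th _; rewrite ler_piMl ?base_pay_ge0//.
exact: regulated_belief_le1.
Qed.

Lemma measurable_own_value i (t : T i) : measurable_fun setT (own_value v t).
Proof.
apply: measurable_sum => a; apply: measurable_funM => //.
apply: (measurableT_proj (F := idfun) (G := fun r : S i => r a)); first exact: measurable_id.
exact: measurable_mass.
Qed.

Lemma measurable_SMA_utility b i (t : T i) :
  measurable_fun setT (fun s => utility (own_value v) SMA t b s).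
Proof.
have [_ _ _ ma mp] := SMA_is_mechanism.
apply: measurable_funB.
  apply: measurable_funM; last exact: measurable_own_value.
  exact: (measurableT_comp (ma i) (measurable_pair1 b)).
exact: (measurableT_comp (mp i) (measurable_pair1 b)).
Qed.

End SMA.

(** * Supports, garblings and integrals of beliefs *)

Lemma measurable_belief_ball {R : realType} {A : finPointedType} (c : A -> R) (e : R) :
  measurable [set s : dist R A | forall a, `|s a - c a| < e].
Proof.
rewrite (_ : [set s | _] = \bigcap_(a in setT) [set s : dist R A | `|s a - c a| < e]); last first.
  by apply/seteqP; split => s /= H a; [move=> _; exact: H|exact: H].
apply: fin_bigcap_measurable; first exact: finite_finset.
move=> a _; rewrite (_ : [set s | _] = (fun s : dist R A => `|s a - c a|) @^-1` `]-oo, e[).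
  rewrite -[X in measurable X]setTI; apply: measurableT_comp => //.
  by apply: measurable_funB => //; exact: measurable_mass.
by apply/seteqP; split => s; rewrite /= in_itv.
Qed.

(** A belief outside the support has a null neighbourhood, hence lies in a null ball with rational
    centre and radius [1 / (k + 1)], and there are countably many of these. The centres are rational
    vectors and need not be beliefs. *)
Lemma belief_support_negligible {R : realType} {A : finPointedType}
    (mu : probability (dist R A) R) : mu.-negligible (~` belief_support mu).
Proof.
pose B (z : {ffun A -> rat} * nat) := [set s : dist R A |
  forall a, `|s a - ratr (z.1 a)| < z.2.+1%:R^-1].
pose N := [set z | mu (B z) = 0].
have sub : ~` belief_support mu `<=` \bigcup_(z in N) B z.
  move=> s; rewrite /belief_support/= => /existsNP[e /not_implyP[e0 /negP]].
  rewrite -leNgt measure_le0 => /eqP mu0.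
  have [k ke] : exists k : nat, k.+1%:R^-1 < e / 2.
    have : 0 < e / 2 by rewrite divr_gt0.
    by move=> /ltr_add_invr[k]; rewrite add0r => ?; exists k.
  have /choice[q Hq] : forall a, exists q : rat, `|s a - ratr q| < k.+1%:R^-1.
    move=> a; have [q] : exists q : rat, ratr q \in `]s a, s a + k.+1%:R^-1[.
      by apply: rat_in_itvoo; rewrite ltrDl invr_gt0.
    rewrite in_itv/= => /andP[q1 q2]; exists q.
    by rewrite ltr0_norm ?subr_lt0// opprB ltrBlDl.
  exists ([ffun a => q a], k); last by move=> a; rewrite /= ffunE.
  apply: (subset_measure0 _ _ _ mu0).
  - exact: measurable_belief_ball.
  - exact: measurable_belief_ball.
  move=> s' /= H a; have := H a; rewrite ffunE => H1; have H2 := Hq a.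
  rewrite (_ : s' a - s a = (s' a - ratr (q a)) - (s a - ratr (q a))); last by ring.
  apply: le_lt_trans (ler_normB _ _) _; apply: lt_le_trans (ltrD H1 H2) _.
  by rewrite [leRHS](splitr e) lerD ?(ltW ke).
pose F (j : nat) : set (dist R A) :=
  if unpickle j is Some z then (if z \in N then B z else set0) else set0.
have FN j : mu.-negligible (F j).
  rewrite /F; case: unpickle => [z|]; last exact: negligible_set0.
  case: ifPn => [/set_mem Nz|_]; last exact: negligible_set0.
  by exists (B z); split => //; exact: measurable_belief_ball.
apply: negligibleS (negligible_bigcup FN).
move=> s /sub[z Nz Bz]; exists (pickle z) => //.
by rewrite /F pickleK mem_set.
Qed.

(** The martingale condition of the coupling, taken on the whole space. *)
Lemma mps_mean {R : realType} {A : finPointedType}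
    (tau lam : probability (dist R A) R) (a : A) : mps tau lam ->
  \int[lam]_s (s a : R) = \int[tau]_s (s a : R).
Proof.
move=> [Q [Q1 Q2 Qm]].
have := Qm setT a measurableT; rewrite setXTT => E.
have push (m : probability (dist R A) R) (F : dist R A * dist R A -> dist R A) :
    measurable_fun setT F -> (forall B, measurable B -> Q (F @^-1` B) = m B) ->
    \int[m]_s (s a : R) = \int[Q]_z (F z a : R).
  move=> mF QF; rewrite /Rintegral; congr fine.
  transitivity (\int[pushforward Q F]_s (s a)%:E)%E.
    by apply: eq_measure_integral => B mB _; exact: esym (QF B mB).
  rewrite (ge0_integral_pushforward mF)//.
    by apply/measurable_EFinP; exact: measurable_mass.
  by move=> s _; rewrite lee_fin mass_ge0.
rewrite (push lam snd)//; last first.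
  move=> B mB; rewrite -(Q2 B mB); congr (Q _).
  by apply/seteqP; split => -[? ?] //= [].
rewrite (push tau fst)//; last first.
  move=> B mB; rewrite -(Q1 B mB); congr (Q _).
  by apply/seteqP; split => -[? ?] //= [].
Qed.

(** The diagonal coupling; it makes a deviation in the type alone admissible. *)
Lemma mps_refl {R : realType} {A : finPointedType} (tau : probability (dist R A) R) :
  mps tau tau.
Proof.
pose D (s : dist R A) := (s, s).
have mD : measurable_fun setT D by exact: measurable_fun_pair.
pose D' : {mfun dist R A >-> (dist R A * dist R A)%type} :=
  HB.pack D (isMeasurableFun.Build _ _ _ _ D mD).
exists (distribution tau D'); split.
- move=> B mB; rewrite /distribution/= /pushforward; congr (tau _).
  by apply/seteqP; split => s //= [].
- move=> B mB; rewrite /distribution/= /pushforward; congr (tau _).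
  by apply/seteqP; split => s //= [].
move=> B a mB; rewrite /Rintegral; congr fine.
have mSB : measurable ([set: dist R A] `*` B) by exact: measurableX.
rewrite /distribution/= !(ge0_integral_pushforward mD)//.
- by apply/measurable_EFinP; apply: measurable_funTS; exact: measurableT_comp (measurable_mass a) measurable_snd.
- by move=> z _; rewrite lee_fin mass_ge0.
- by apply/measurable_EFinP; apply: measurable_funTS; exact: measurableT_comp (measurable_mass a) measurable_fst.
- by move=> z _; rewrite lee_fin mass_ge0.
Qed.

(** Adding [M] makes the integrand nonnegative, so that Tonelli applies. *)
Lemma measurable_integral_bounded {d1 d2} {T1 : measurableType d1}
    {T2 : measurableType d2} {R : realType} (mu : probability T2 R)
    (F : T1 -> T2 -> R) (M : R) :
  measurable_fun setT (fun z => F z.1 z.2) -> (forall x y, `|F x y| <= M) ->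
  measurable_fun setT (fun x => \int[mu]_y (F x y)%:E)%E.
Proof.
move=> mF FM.
rewrite (_ : (fun x => _) = (fun x => \int[mu]_y (F x y + M)%:E - M%:E)%E).
  apply: emeasurable_funB; last exact: measurable_cst.
  apply: (@measurable_integral_EFin _ _ _ _ _ mu (fun x y => F x y + M)).
    exact: measurable_funD.
  by move=> x y; have := FM x y; rewrite ler_norml; lra.
apply/funext => x.
under [in RHS]eq_integral do rewrite EFinD.
rewrite integralD//; last 2 first.
- apply: (@bounded_integrable _ _ _ _ _ M); last by move=> y; rewrite /= lee_fin.
  by apply/measurable_EFinP; exact: (measurable_fun_section (F := F) _ mF).
- exact: finite_measure_integrable_cst.
rewrite integral_cst//= probability_setT mule1 addeK//.
Qed.

Lemma bounded_integral_le {d} {T : measurableType d} {R : realType}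
    (P : probability T R) (F : T -> \bar R) (M : R) :
  measurable_fun setT F -> (forall t, `|F t| <= M%:E)%E ->
  (`|\int[P]_t F t| <= M%:E)%E.
Proof.
move=> mF FM; apply: le_trans (le_abse_integral _ _ _) _ => //.
apply: (@le_trans _ _ (\int[P]_t M%:E)%E); last first.
  by rewrite integral_cst//= probability_setT mule1.
apply: ge0_le_integral => //.
exact: measurableT_comp.
Qed.

Lemma mass_integrable {R : realType} {A : finPointedType}
    (mu : probability (dist R A) R) (a : A) :
  mu.-integrable setT (fun r => (r a)%:E).
Proof.
apply: (@bounded_integrable _ _ _ _ _ 1).
  by apply/measurable_EFinP; exact: measurable_mass.
by move=> r; rewrite /= lee_fin ger0_norm ?mass_ge0// dist_le1.
Qed.

(** A function linear in the belief has an integral that depends on the law only through its mean;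
    this is why garbling cannot raise the bound on utilities. *)
Lemma integral_mass_comb {R : realType} {A : finPointedType} {I : finType}
    (mu : probability (dist R A) R) (k : I -> R) (e : I -> A) :
  (\int[mu]_r (\sum_j k j * r (e j))%:E =
   (\sum_j k j * \int[mu]_r (r (e j) : R)%R)%R%:E)%E.
Proof.
under eq_integral do rewrite -sumEFin.
rewrite integral_sum//; last first.
  by move=> j; under eq_fun do rewrite EFinM; exact/integrableZl/mass_integrable.
rewrite -sumEFin; apply: eq_bigr => j _.
under eq_integral do rewrite EFinM.
rewrite integralZl//; last exact: mass_integrable.
by rewrite EFinM /Rintegral fineK// integrable_fin_num//; exact: mass_integrable.
Qed.

(** * Incentives under information regulation *)

Section DominantStrategy.
Context {R : realType} {n : nat} {d : measure_display}.
Context {T : 'I_n -> measurableType d} {h : forall i, probability (T i) R}.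
Context {Th : 'I_n -> finPointedType}.
Variable v : forall i, Th i -> {RV (h i) >-> R}.
Arguments v : clear implicits.
Variable f : forall i, Th i -> R -> R.
Arguments f : clear implicits.
Local Notation S := (@signal R n Th).
Local Notation states := {dffun forall i, Th i}.
Hypothesis mf : forall i a, measurable_fun setT (f i a).
Hypothesis f_ge0 : forall i a r, 0 <= f i a r.
Hypothesis phi_regular : regular_virtual_values v f.
Hypothesis v_regular : regular_values v.
Notation SMA := (simulated_myerson v f (@regulated_belief R n Th)).
Notation x b th i := (base_alloc v f b th i).
Notation p b th i := (base_pay v f b th i).
Variables (g : dist R states) (tau : forall i, probability (S i) R).
Hypothesis info_sufficient : information_sufficiency v f tau.

Lemma measurable_upd_signal i :
  measurable_fun setT (fun z : profile S * S i => upd_signal z.1 z.2).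
Proof.
by apply: measurable_dfwith; [exact: measurable_fst|exact: measurable_snd].
Qed.

Lemma SMA_dominant_strategy : regulated_dominant_strategy_IIC v g tau SMA.
Proof.
move=> i t b lam L mpsH _; rewrite /regulated_utility.
set b' := upd_type b t.
pose u (th : states) := x b' th i * v i (th i) t - p b' th i.
pose m a := \int[tau i]_r (r a : R).
(* What truth yields given the others' signals: the linear function of the own belief evaluated at
   the mean of [tau i]. *)
pose C s := \sum_(th : states) (belief_others s i th * u th) * m (th i).
have mU (c : profile T) : measurable_fun setT
    (fun z : profile S * S i => utility (own_value v) SMA t c (upd_signal z.1 z.2)).
  apply: (measurableT_comp (f := fun s => utility (own_value v) SMA t c s)).
    exact: measurable_SMA_utility.
  exact: measurable_upd_signal.
have mUs c s : measurable_fun setT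
    (fun r : S i => utility (own_value v) SMA t c (upd_signal s r)).
  exact: (measurable_fun_section
    (F := fun s r => utility (own_value v) SMA t c (upd_signal s r)) _ (mU c)).
have [M [M0 UM]] := SMA_utility_bound v mf f_ge0 b t.
have [M' [M'0 UM']] := SMA_utility_bound v mf f_ge0 b' t.
(* Information sufficiency is assumed on the support only, which carries all of [tau i]. *)
have UE2 s : (\int[tau i]_r (utility (own_value v) SMA t b' (upd_signal s r))%:E = (C s)%:E)%E.
  rewrite -(integral_mass_comb (tau i)
    (fun th : states => belief_others s i th * u th) (fun th : states => th i)).
  apply: ae_eq_integral => //.
  - apply/measurable_EFinP.
    exact: mUs.
  - apply/measurable_EFinP; apply: measurable_sum => th; apply: measurable_funM => //.
    exact: measurable_mass.
  have := belief_support_negligible (tau i); apply: negligibleS => r /=.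
  apply: contra_not => supp_r _; congr (_%:E).
  rewrite SMA_utility_sufficient; last first.
    by move=> th; rewrite upd_signal_in; exact: info_sufficient.
  by apply: eq_bigr => th _; rewrite regulated_belief_upd_signal /u; ring.
(* The garbled experiment has the same mean, so [C s] can be written with [lam i]; then compare
   integrands at every belief, first by Chebyshev, then by truthfulness of Myerson's auction in each
   state. *)
have UE1 s : (\int[lam i]_r (utility (own_value v) SMA t b (upd_signal s r))%:E <= (C s)%:E)%E.
  have -> : C s = \sum_(th : states) (belief_others s i th * u th) * \int[lam i]_r (r (th i) : R).
    by apply: eq_bigr => th _; rewrite (mps_mean _ (mpsH i)).
  rewrite -(integral_mass_comb (lam i)
    (fun th : states => belief_others s i th * u th) (fun th : states => th i)).
  apply: le_integral => //.
  - apply: (@bounded_integrable _ _ _ _ _ M); last by move=> r; rewrite /= lee_fin.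
    apply/measurable_EFinP.
    exact: mUs.
  - under eq_fun do rewrite -sumEFin.
    apply: integrable_sum => // th _; under eq_fun do rewrite EFinM.
    exact/integrableZl/mass_integrable.
  move=> r _; rewrite lee_fin.
  apply: le_trans (SMA_utility_le _ _ _ _ _) _ => //.
  apply: ler_sum => th _; rewrite regulated_belief_upd_signal.
  rewrite mulrAC ler_wpM2r ?mass_ge0// ler_wpM2l//.
    by apply: prodr_ge0 => j _; exact: mass_ge0.
  exact: base_DSIC.
under [leRHS]eq_integral do rewrite UE2.
have mI (mu : probability (S i) R) (c : profile T) K :
    (forall s, `|utility (own_value v) SMA t c s| <= K) ->
    L.-integrable setT
      (fun s => \int[mu]_r (utility (own_value v) SMA t c (upd_signal s r))%:E)%E.
  move=> UK; apply: (@bounded_integrable _ _ _ _ _ K).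
    by apply: (@measurable_integral_bounded _ _ _ _ _ mu
      (fun s r => utility (own_value v) SMA t c (upd_signal s r)) K).
  move=> s; apply: bounded_integral_le; last by move=> r; rewrite /= lee_fin.
  apply/measurable_EFinP.
  exact: mUs.
apply: le_integral => //; first exact: mI UM.
apply: eq_integrable (mI (tau i) b' M' UM') => // s _; exact: UE2.
Qed.

End DominantStrategy.

(** * Independent types and the law of truthful signals *)

Lemma ge0_integral_sum_EFin {d} {T : measurableType d} {R : realType}
    (mu : {measure set T -> \bar R}) (I : finType) (F : I -> T -> R) :
  (forall i, measurable_fun setT (F i)) -> (forall i t, 0 <= F i t) ->
  (\int[mu]_t (\sum_i F i t)%:E = \sum_i \int[mu]_t (F i t)%:E)%E.
Proof.
move=> mF F0; under eq_integral do rewrite -sumEFin.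
rewrite ge0_integral_sum//.
- by move=> i; exact/measurable_EFinP.
- by move=> i t _; rewrite lee_fin.
Qed.

Section ProductLaw.
Context {R : realType} {n : nat} {d : measure_display}.
Context {T : 'I_n -> measurableType d}.
Variables (h : forall i, probability (T i) R) (H : probability (profile T) R).
Hypothesis H_indep : product_law h H.

Definition rectangles : set (set (profile T)) :=
  [set C | exists2 B : forall i, set (T i), forall i, measurable (B i) &
     C = [set t : profile T | forall i, B i (t i)]].

Lemma measurable_rectangle (B : forall i, set (T i)) : (forall i, measurable (B i)) ->
  measurable [set t : profile T | forall i, B i (t i)].
Proof.
move=> mB; rewrite (_ : [set t | _] = \bigcap_(i in setT) [set t : profile T | B i (t i)]).
  apply: fin_bigcap_measurable; first exact: finite_finset.
  move=> i _; rewrite -[X in measurable X]setTI.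
  exact: (@measurable_proj_profile _ _ T i measurableT _ (mB i)).
by apply/seteqP; split => t /= Ht i; [move=> _; exact: Ht|exact: Ht].
Qed.

Lemma rectangles_generate : @measurable _ (profile T) = <<s rectangles >>.
Proof.
apply/seteqP; split.
  apply: sub_sigma_algebra2 => _ [i [B mB ->]].
  exists (dfwith (fun j => [set: T j]) i B).
    move=> j; have [<-|ij] := eqVneq i j; first by rewrite dfwithin.
    by rewrite dfwithout.
  apply/seteqP; split => t /=.
    move=> Bt j; have [<-|ij] := eqVneq i j; first by rewrite dfwithin.
    by rewrite dfwithout.
  by move=> /(_ i); rewrite dfwithin.
apply: smallest_sub; first exact: sigma_algebra_measurable.
by move=> _ [B mB ->]; exact: measurable_rectangle.
Qed.

Lemma resample_preimage i (B : forall i, set (T i)) :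
  (fun z : profile T * T i => upd_type z.1 z.2) @^-1` [set t | forall j, B j (t j)] =
  [set t : profile T | forall j, dfwith B i setT j (t j)] `*` B i.
Proof.
apply/seteqP; split => -[t r] /=.
  move=> Bt; split; last by have := Bt i; rewrite upd_type_in.
  move=> j /=; have [<-|ij] := eqVneq i j; first by rewrite dfwithin.
  by rewrite dfwithout//; have := Bt j; rewrite upd_type_out// eq_sym.
move=> [Bt Br] j; have [<-|ij] := eqVneq i j; first by rewrite upd_type_in.
by have := Bt j; rewrite dfwithout// upd_type_out// eq_sym.
Qed.

Lemma measurable_upd_type i :
  measurable_fun setT (fun z : profile T * T i => upd_type z.1 z.2).
Proof.
by apply: measurable_dfwith; [exact: measurable_fst|exact: measurable_snd].
Qed.

(** Redrawing the type of bidder [i] leaves the law of the profile unchanged: this holds on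
    rectangles, which are stable under intersection and generate the sigma-algebra. It reduces an
    expectation over profiles to one over the own type, the others being fixed. *)
Lemma product_law_resample i (F : profile T -> \bar R) :
  measurable_fun setT F -> (forall t, 0 <= F t)%E ->
  (\int[H]_t F t = \int[H]_t \int[h i]_r F (upd_type t r))%E.
Proof.
move=> mF F0.
pose Phi (z : profile T * T i) : profile T := upd_type z.1 z.2.
have mPhi : measurable_fun setT Phi by exact: measurable_upd_type.
have key (B : forall i, set (T i)) : (forall i, measurable (B i)) ->
    (H \x h i)%E (Phi @^-1` [set t : profile T | forall i, B i (t i)]) =
    H [set t : profile T | forall i, B i (t i)].
  move=> mB.
  have mB' : forall j, measurable (dfwith B i setT j).
    move=> j; have [<-|ij] := eqVneq i j; first by rewrite dfwithin.
    by rewrite dfwithout.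
  rewrite resample_preimage product_measure1E//; last exact: measurable_rectangle.
  rewrite (H_indep mB).
  transitivity ((\prod_(j < n) fine (h j (dfwith B i setT j)))%:E * (fine (h i (B i)))%:E)%E.
    congr (_ * _)%E; first exact: H_indep.
    by rewrite fineK// fin_num_measure//; exact: mB.
  rewrite -EFinM; congr (_%:E).
  rewrite (bigD1 i)//= [in RHS](bigD1 i)//= dfwithin probability_setT mul1r mulrC.
  by congr (_ * _); apply: eq_bigr => j ji; rewrite dfwithout// eq_sym.
transitivity (\int[pushforward (H \x h i)%E Phi]_t F t)%E.
  apply: eq_measure_integral => C mC _.
  apply: (@measure_unique _ _ _ rectangles (fun=> setT)) => //.
  - exact: rectangles_generate.
  - move=> _ _ [B mB ->] [B' mB' ->]; exists (fun i => B i `&` B' i).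
      by move=> j; exact: measurableI.
    apply/seteqP; split => t /=; first by move=> [Bt B't] j.
    by move=> BB; split => j; have [] := BB j.
  - by move=> _; exists (fun=> setT) => //; apply/seteqP; split.
  - by rewrite bigcup_const.
  - by move=> _ [B mB ->]; exact: esym (key B mB).
  - move=> _; apply: (@le_lt_trans _ _ 1%E); last exact: ltry.
    exact: probability_le1.
rewrite (ge0_integral_pushforward mPhi)//=.
rewrite (@fubini_tonelli1 _ _ _ _ _ H (h i) (F \o Phi))//.
  exact: measurableT_comp mF mPhi.
by move=> t; exact: F0.
Qed.

End ProductLaw.

Section TruthfulSignals.
Context {R : realType} {n : nat} {Th : 'I_n -> finPointedType}.
Local Notation S := (@signal R n Th).
Local Notation states := {dffun forall i, Th i}.
Variables (g : dist R states) (tau : forall i, probability (S i) R).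
Variable Tau : probability (profile S) R.
Hypothesis Tau_law : joint_law g tau Tau.

(** In every term of the joint law, the factor of bidder [i] is an integral against [tau i], so a
    null set of [tau i] stays null in coordinate [i]. *)
Lemma joint_law_support : {ae Tau, forall s i, belief_support (tau i) (s i)}.
Proof.
apply: filter_forall => i.
have [N [mN N0 suppN]] := belief_support_negligible (tau i).
pose B := dfwith (fun j => [set: S j]) i N.
have mB j : measurable (B j).
  rewrite /B; have [<-|ij] := eqVneq i j; first by rewrite dfwithin.
  by rewrite dfwithout.
exists [set s : profile S | forall j, B j (s j)]; split.
- exact: measurable_rectangle.
- rewrite Tau_law// big1// => th _.
  rewrite (bigD1 i)//= /B dfwithin /Rintegral null_set_integral//=.
    by rewrite mul0r mulr0.
  apply/measurable_EFinP; apply: measurable_funTS; apply: measurable_funM => //.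
  exact: measurable_mass.
move=> s /= /suppN Ns j; rewrite /B; have [<-|ij] := eqVneq i j.
  by rewrite dfwithin.
by rewrite dfwithout.
Qed.

End TruthfulSignals.

(** * Revenue *)

Section Optimality.
Context {R : realType} {n : nat} {d : measure_display}.
Context {T : 'I_n -> measurableType d} {h : forall i, probability (T i) R}.
Context {Th : 'I_n -> finPointedType}.
Variable v : forall i, Th i -> {RV (h i) >-> R}.
Arguments v : clear implicits.
Variable f : forall i, Th i -> R -> R.
Arguments f : clear implicits.
Hypothesis f_ge0 : forall i a r, 0 <= f i a r.
Implicit Types (b : profile T) (th : forall i, Th i).
Notation x b th i := (base_alloc v f b th i).
Notation p b th i := (base_pay v f b th i).

(** The winner is the maximiser of smallest index, as the tie-breaking demands. *)
Lemma base_alloc_winner b th j : 0 < phi v f (th j) (b j) -> exists i, x b th i = 1.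
Proof.
move=> pj0.
pose best i := [forall k, phi v f (th k) (b k) <= phi v f (th i) (b i)].
have [i0 bi0] : exists i, best i.
  have [i _ Hi] := @Order.TotalTheory.arg_maxP _ R 'I_n j predT (fun k => phi v f (th k) (b k)) isT.
  by exists i; apply/forallP => k; exact: Hi.
have [i bi mini] := @arg_minnP 'I_n i0 best (fun k => k : nat) bi0.
exists i; rewrite /base_alloc /myerson_alloc.
have /forallP Hi := bi.
rewrite [0 < _](lt_le_trans pj0 (Hi j))/=.
suff -> : [forall k : 'I_n, (k != i) ==>
      if (i < k)%N then virtual v f (th k) (v k (th k) (b k)) <= virtual v f (th i) (v i (th i) (b i))
      else virtual v f (th k) (v k (th k) (b k)) < virtual v f (th i) (v i (th i) (b i))] by [].
apply/forallP => k; apply/implyP => ki; case: ifPn => [_|]; first exact: Hi.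
rewrite -leqNgt => leki; rewrite lt_neqAle [_ <= _]Hi andbT.
apply/negP => /eqP kE.
have /mini : best k.
  by apply/forallP => l; apply: le_trans (Hi l) _; rewrite /phi kE.
move=> leik; move/eqP: ki; apply; apply/val_inj/eqP.
by rewrite eqn_leq leki leik.
Qed.

(** Weights of total at most 1 cannot exceed the largest positive virtual value, which the winner
    realises; with no positive one, the left side is at most 0. *)
Lemma base_alloc_optimal b th (w : 'I_n -> R) :
  (forall i, 0 <= w i) -> \sum_i w i <= 1 ->
  \sum_i w i * phi v f (th i) (b i) <= \sum_i x b th i * phi v f (th i) (b i).
Proof.
move=> w0 w1; have [/existsP[j pj0]|/existsPn no] :=
  boolP [exists j, 0 < phi v f (th j) (b j)]; last first.
  apply: (@le_trans _ _ 0).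
    by apply: sumr_le0 => i _; rewrite mulr_ge0_le0// leNgt no.
  apply: sumr_ge0 => i _; have [->|/base_alloc_phi[pi0 _]] := eqVneq (x b th i) 0.
    by rewrite mul0r.
  by rewrite mulr_ge0 ?base_alloc_ge0// ltW.
have [i xi] := base_alloc_winner pj0.
have : x b th i != 0 by rewrite xi oner_neq0.
move=> /base_alloc_phi[pi0 zi].
apply: (@le_trans _ _ (\sum_k w k * phi v f (th i) (b i))).
  apply: ler_sum => k _; rewrite ler_wpM2l//.
  have [->//|ki] := eqVneq k i; apply: le_trans zi; exact: phi_le_threshold.
rewrite -mulr_suml; apply: (@le_trans _ _ (phi v f (th i) (b i))).
  by rewrite ler_piMl// ltW.
rewrite (bigD1 i)//= xi mul1r lerDl; apply: sumr_ge0 => k _.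
have [->|/base_alloc_phi[pk0 _]] := eqVneq (x b th k) 0; first by rewrite mul0r.
by rewrite mulr_ge0 ?base_alloc_ge0// ltW.
Qed.

Hypothesis mf : forall i a, measurable_fun setT (f i a).
Hypothesis f_density : value_density v f.
Hypothesis f_positive : positive_density v f.
Hypothesis phi_regular : regular_virtual_values v f.

(** The inverse hazard rate, that is, value minus virtual value. *)
Definition markup i (a : Th i) (r : R) : R := (1 - value_cdf v a r) / f i a r.

Lemma markup_ge0 i (a : Th i) r : 0 <= markup a r.
Proof. by rewrite divr_ge0// subr_ge0 value_cdf_le1. Qed.

Lemma phi_markup i (a : Th i) (t : T i) : phi v f a t = v i a t - markup a (v i a t).
Proof. by []. Qed.

Lemma measurable_markup i (a : Th i) : measurable_fun setT (markup a).
Proof.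
apply: measurable_funM; last exact: measurable_fun_ge0_inv.
apply: measurable_funB => //.
by apply: nondecreasing_measurable => // r s; exact: fine_cdf_homo.
Qed.

Lemma base_alloc_value_ge0 b th i : 0 <= x b th i * v i (th i) (b i).
Proof.
have [->|/base_alloc_phi[p0 _]] := eqVneq (x b th i) 0; first by rewrite mul0r.
rewrite mulr_ge0 ?base_alloc_ge0// ltW// (lt_le_trans p0)//.
exact: phi_le_value.
Qed.

(** For fixed opponents, bidder [i] faces a posted price [c], and [monopoly_payment] bounds his mean
    surplus over [c] by the mean markup above [c]. The price [c] is an infimum of values, as that
    lemma requires; if no type reaches the threshold, he never wins. *)
Lemma base_payment b th i :
  (\int[h i]_r (x (upd_type b r) th i * v i (th i) r)%:E <=
   \int[h i]_r (p (upd_type b r) th i)%:E +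
   \int[h i]_r (x (upd_type b r) th i * markup (th i) (v i (th i) r))%:E)%E.
Proof.
set z := \big[Num.max/0]_(j < n | j != i) phi v f (th j) (b j).
have zE (r : T i) : \big[Num.max/0]_(j < n | j != i) phi v f (th j) (upd_type b r j) = z.
  by apply: eq_bigr => j ji; rewrite (upd_type_out _ _ ji).
set c := critical_value v f (th i) z.
have z0 : 0 <= z by exact: threshold_ge0.
have mupd : measurable_fun setT (fun r : T i => upd_type b r).
  by apply: measurable_dfwith => //; exact: measurable_cst.
have mx : measurable_fun setT (fun r : T i => x (upd_type b r) th i).
  exact: (measurableT_comp (measurable_base_alloc v mf f_ge0 th i) mupd).
have mp : measurable_fun setT (fun r : T i => p (upd_type b r) th i).
  exact: (measurableT_comp (measurable_base_pay v mf f_ge0 th i) mupd).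
have mv : measurable_fun setT (v i (th i)) by exact: measurable_funPT.
have mm : measurable_fun setT (fun r => x (upd_type b r) th i * markup (th i) (v i (th i) r)).
  by apply: measurable_funM => //; exact: measurableT_comp (measurable_markup _) mv.
have xv0 r : 0 <= x (upd_type b r) th i * v i (th i) r.
  by have := base_alloc_value_ge0 (upd_type b r) th i; rewrite upd_type_in.
have xm0 r : 0 <= x (upd_type b r) th i * markup (th i) (v i (th i) r).
  by rewrite mulr_ge0 ?base_alloc_ge0// markup_ge0.
have [[t0 zt0]|no] := pselect (exists t0, z <= phi v f (th i) t0); last first.
  rewrite integral0_eq; last first.
    move=> r _; have [->|/base_alloc_phi[_]] := eqVneq (x (upd_type b r) th i) 0.
      by rewrite mul0r.
    by rewrite zE upd_type_in => zr; exfalso; apply: no; exists r.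
  apply: adde_ge0; apply: integral_ge0 => r _; rewrite lee_fin//.
  exact: base_pay_ge0.
have crit r : c < r -> exists2 t, z <= phi v f (th i) t & v i (th i) t < r.
  have ne : [set v i (th i) t | t in [set t | z <= phi v f (th i) t]] !=set0.
    by exists (v i (th i) t0), t0.
  by move=> /(inf_lt ne)[_ [t /= zt <-] tr]; exists t.
have win r : c < v i (th i) r -> x (upd_type b r) th i = 1.
  move=> cr; apply: phi_base_alloc; rewrite zE upd_type_in.
  have [t zt tr] := crit _ cr.
  apply: le_lt_trans zt _; rewrite ltNge; apply/negP => /phi_regular.
  by rewrite leNgt tr.
pose I r := (c < v i (th i) r)%R%:R : R.
have mI : measurable_fun setT I by exact: measurable_fun_ltr_natr.
have mvI : measurable_fun setT (fun r => (v i (th i) r - c) * I r).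
  by apply: measurable_funM => //; exact: measurable_funB.
have vI0 r : 0 <= (v i (th i) r - c) * I r.
  rewrite /I; case: ltrP => [cr|_]; last by rewrite mulr0.
  by rewrite mulr1 subr_ge0 ltW.
(* The allocation can be replaced by the indicator of values above [c]: at other values, winning
   does not contribute a positive surplus. *)
apply: (@le_trans _ _ (\int[h i]_r (p (upd_type b r) th i)%:E +
    \int[h i]_r ((v i (th i) r - c) * I r)%:E)%E).
  rewrite -ge0_integralD//; last 4 first.
  - by move=> r _; rewrite lee_fin base_pay_ge0.
  - exact/measurable_EFinP.
  - by move=> r _; rewrite lee_fin.
  - exact/measurable_EFinP.
  under [leRHS]eq_integral do rewrite -EFinD.
  apply: ge0_le_integral_EFin => //.
  - exact: measurable_funM.
  - exact: measurable_funD.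
  move=> r; rewrite base_payE zE -/c -lerBlDl -mulrBr.
  have [->|xr] := eqVneq (x (upd_type b r) th i) 0; first by rewrite mul0r.
  have [x1|/base_alloc_eq0 x1] := eqVneq (x (upd_type b r) th i) 1; last first.
    by rewrite x1 eqxx in xr.
  rewrite x1 mul1r /I; case: ltrP => [_|cr]; first by rewrite mulr1.
  by rewrite mulr0 subr_le0.
apply: leeD2l.
have [_ _ fd] := f_density (th i).
apply: le_trans (monopoly_payment (mf (th i)) (f_ge0 (th i)) fd (f_positive (i := i) (a := th i)) _) _.
  move=> r cr.
  have [t zt tr] := crit _ cr.
  by exists t.
apply: ge0_le_integral_EFin => //.
- rewrite (_ : (fun r => _) = (fun r => I r * markup (th i) (v i (th i) r))).
    by apply: measurable_funM => //; exact: measurableT_comp (measurable_markup _) mv.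
  by apply/funext => r; rewrite /markup mulrA.
- move=> r; rewrite -mulrA mulr_ge0//.
  exact: markup_ge0.
move=> r; rewrite -mulrA; have [/win ->//|_] := ltrP c (v i (th i) r).
by rewrite mul0r.
Qed.

End Optimality.

(** * Reduced form of a competing mechanism and the revenue comparison *)

Section Revenue.
Context {R : realType} {n : nat} {d : measure_display}.
Context {T : 'I_n -> measurableType d} {h : forall i, probability (T i) R}.
Context {Th : 'I_n -> finPointedType}.
Variable v : forall i, Th i -> {RV (h i) >-> R}.
Arguments v : clear implicits.
Variable f : forall i, Th i -> R -> R.
Arguments f : clear implicits.
Variable H : probability (profile T) R.
Local Notation S := (@signal R n Th).
Local Notation states := {dffun forall i, Th i}.
Variables (g : dist R states) (tau : forall i, probability (S i) R).
Variable Tau : probability (profile S) R.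
Hypothesis H_indep : product_law h H.
Hypothesis f_density : value_density v f.
Hypothesis v_finite_mean : finite_mean_values v.
Hypothesis f_positive : positive_density v f.
Hypothesis T_ordered : ordered_types v.
Hypothesis Tau_law : joint_law g tau Tau.
Hypothesis phi_regular : regular_virtual_values v f.
Variable V : forall i, T i -> profile S -> R.
Hypothesis mV : forall i (t : T i), measurable_fun setT (V t).
Hypothesis V_own : {ae Tau, forall s i (t : T i), V t s = own_value v t s}.
Variable M : @mechanism R n d T Th.
Hypothesis M_mechanism : is_mechanism M.
Hypothesis M_IIC : ex_post_IIC g tau Tau V M.
Hypothesis M_IR : ex_post_IR tau V M.
Notation markup := (markup v f).
Implicit Types (t : profile T) (s : profile S).

(** The allocation is weighted by the own belief before averaging: then the mean utility of any true
    type is linear in his values, with these coefficients fixed by the report alone. *)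
Definition mean_alloc i (a : Th i) t : R := \int[Tau]_s (alloc M i t s * s i a).
Definition mean_pay i t : R := \int[Tau]_s (pay M i t s).

Lemma alloc_ge0 i t s : 0 <= alloc M i t s.
Proof. by have [h0 _ _ _ _] := M_mechanism. Qed.

Lemma pay_ge0 i t s : 0 <= pay M i t s.
Proof. by have [_ h0 _ _ _] := M_mechanism. Qed.

Lemma alloc_le1 i t s : alloc M i t s <= 1.
Proof.
have [_ _ h1 _ _] := M_mechanism; apply: le_trans (h1 t s).
by rewrite (bigD1 i)//= lerDl; apply: sumr_ge0 => j _; exact: alloc_ge0.
Qed.

Lemma measurable_signal_mass i (a : Th i) : measurable_fun setT (fun s => s i a : R).
Proof.
apply: (measurableT_proj (F := idfun) (G := fun r : S i => r a)); first exact: measurable_id.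
exact: measurable_mass.
Qed.

Lemma measurable_alloc i t : measurable_fun setT (alloc M i t).
Proof.
by have [_ _ _ ma _] := M_mechanism; exact: (measurableT_comp (ma i) (measurable_pair1 t)).
Qed.

Lemma measurable_pay i t : measurable_fun setT (pay M i t).
Proof.
by have [_ _ _ _ mp] := M_mechanism; exact: (measurableT_comp (mp i) (measurable_pair1 t)).
Qed.

Lemma alloc_mass_bound i (a : Th i) t s : 0 <= alloc M i t s * s i a <= 1.
Proof. by rewrite mulr_ge0 ?alloc_ge0 ?mass_ge0//= mulr_ile1 ?alloc_ge0 ?mass_ge0 ?alloc_le1 ?dist_le1. Qed.

Lemma integrable_alloc_mass i (a : Th i) t :
  Tau.-integrable setT (fun s => (alloc M i t s * s i a)%:E).
Proof.
apply: (@bounded_integrable _ _ _ _ _ 1).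
  apply/measurable_EFinP; apply: measurable_funM; first exact: measurable_alloc.
  exact: measurable_signal_mass.
by move=> s; have /andP[h0 h1] := alloc_mass_bound a t s; rewrite /= lee_fin ger0_norm.
Qed.

Lemma mean_allocE i (a : Th i) t :
  (\int[Tau]_s (alloc M i t s * s i a)%:E = (mean_alloc a t)%:E)%E.
Proof. by rewrite fineK// integrable_fin_num//; exact: integrable_alloc_mass. Qed.

(** Rationality holds on the supports, so one null set of signals serves all types at once. *)
Lemma pay_le_value : {ae Tau, forall s i t, pay M i t s <= alloc M i t s * own_value v (t i) s}.
Proof.
have := joint_law_support Tau_law; have := V_own; apply: filterS2 => s Vs supp_s i t.
by have := M_IR i t supp_s; rewrite /utility Vs subr_ge0.
Qed.

(** Individual rationality bounds the payment by the values of the fixed type in the finitely many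
    states. *)
Lemma integrable_pay i t : Tau.-integrable setT (fun s => (pay M i t s)%:E).
Proof.
apply/integrableP; split; first by apply/measurable_EFinP; exact: measurable_pay.
apply: (@le_lt_trans _ _ (\int[Tau]_s (\sum_a `|v i a (t i)|)%:E)%E); last first.
  by rewrite integral_cst//= probability_setT mule1 ltry.
apply: ae_ge0_le_integral => //.
- by apply/measurable_EFinP; apply: measurableT_comp => //; exact: measurable_pay.
- by move=> s _; rewrite lee_fin sumr_ge0.
have := pay_le_value; apply: filterS => s /(_ i t) ps _.
rewrite /= lee_fin ger0_norm ?pay_ge0//; apply: le_trans ps _.
apply: le_trans (ler_norm _) _; rewrite normrM ger0_norm ?alloc_ge0//.
apply: (@le_trans _ _ `|own_value v (t i) s|); first by rewrite ler_piMl ?alloc_le1.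
exact: mean_bound.
Qed.

Lemma mean_payE i t : (\int[Tau]_s (pay M i t s)%:E = (mean_pay i t)%:E)%E.
Proof. by rewrite fineK// integrable_fin_num//; exact: integrable_pay. Qed.

Lemma alloc_mean_sum i (k : Th i -> R) t s :
  alloc M i t s * mean (s i) k = \sum_a k a * (alloc M i t s * s i a).
Proof. by rewrite /mean mulr_sumr; apply: eq_bigr => a _; ring. Qed.

Lemma mean_alloc_comb i (k : Th i -> R) t :
  (\int[Tau]_s (alloc M i t s * mean (s i) k)%:E = (\sum_a mean_alloc a t * k a)%R%:E)%E.
Proof.
under eq_integral do rewrite alloc_mean_sum -sumEFin.
rewrite integral_sum//; last first.
  by move=> a; under eq_fun do rewrite EFinM; exact/integrableZl/integrable_alloc_mass.
rewrite -sumEFin; apply: eq_bigr => a _.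
under eq_integral do rewrite EFinM.
rewrite integralZl//; last exact: integrable_alloc_mass.
by rewrite mean_allocE -EFinM mulrC.
Qed.

Lemma integrable_alloc_mean i (k : Th i -> R) t :
  Tau.-integrable setT (fun s => (alloc M i t s * mean (s i) k)%:E).
Proof.
under eq_fun do rewrite alloc_mean_sum -sumEFin.
apply: integrable_sum => // a _; under eq_fun do rewrite EFinM.
exact/integrableZl/integrable_alloc_mass.
Qed.

Lemma mean_utility i (r : T i) t :
  (\int[Tau]_s (utility V M r t s)%:E =
   (\sum_a mean_alloc a t * v i a r - mean_pay i t)%:E)%E.
Proof.
transitivity (\int[Tau]_s (alloc M i t s * own_value v r s - pay M i t s)%:E)%E.
  apply: ae_eq_integral => //.
  - apply/measurable_EFinP; apply: measurable_funB; last exact: measurable_pay.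
    by apply: measurable_funM => //; exact: measurable_alloc.
  - apply/measurable_EFinP; apply: measurable_funB; last exact: measurable_pay.
    by apply: measurable_funM; [exact: measurable_alloc|exact: measurable_own_value].
  by have := V_own; apply: filterS => s Vs _; rewrite /utility Vs.
rewrite integralB_EFin//; [|exact: integrable_alloc_mean|exact: integrable_pay].
by rewrite mean_alloc_comb mean_payE -EFinB.
Qed.

Lemma mean_pay_IR i t : mean_pay i t <= \sum_a mean_alloc a t * v i a (t i).
Proof.
rewrite -lee_fin -mean_payE -mean_alloc_comb.
have mp := measurable_pay i t.
(* The value integrand is nonnegative only almost surely; its positive part is nonnegative
   everywhere and has the same integral. *)
rewrite [leRHS](_ : _ = \int[Tau]_s (Num.max 0 (alloc M i t s * own_value v (t i) s))%:E)%E.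
  apply: ae_ge0_le_integral => //.
  - by move=> s _; rewrite lee_fin pay_ge0.
  - exact/measurable_EFinP.
  - by move=> s _; rewrite lee_fin le_max lexx.
  - apply/measurable_EFinP; apply: measurable_maxr => //.
    by apply: measurable_funM; [exact: measurable_alloc|exact: measurable_own_value].
  have := pay_le_value; apply: filterS => s /(_ i t) ps _.
  by rewrite lee_fin le_max ps orbT.
apply: ae_eq_integral => //.
- by apply: measurable_int; exact: integrable_alloc_mean.
- apply/measurable_EFinP; apply: measurable_maxr => //.
  by apply: measurable_funM; [exact: measurable_alloc|exact: measurable_own_value].
have := pay_le_value; apply: filterS => s /(_ i t) ps _.
by rewrite max_r// (le_trans (pay_ge0 i t s)).
Qed.

(** The deviation keeps the experiment [tau i], so the signals still follow [Tau]. *)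
Lemma mean_pay_IC i t (r : T i) :
  \sum_a mean_alloc a (upd_type t r) * v i a (t i) - mean_pay i (upd_type t r) <=
  \sum_a mean_alloc a t * v i a (t i) - mean_pay i t.
Proof.
rewrite -lee_fin -!mean_utility; apply: M_IIC; first exact: mps_refl.
rewrite (_ : dfwith tau i (tau i) = tau)//.
apply: functional_extensionality_dep => j.
by have [<-|ij] := eqVneq i j; [rewrite dfwithin|rewrite dfwithout].
Qed.

Lemma mean_alloc_ge0 i (a : Th i) t : 0 <= mean_alloc a t.
Proof. by apply: Rintegral_ge0 => s _; have /andP[] := alloc_mass_bound a t s. Qed.

Lemma mean_alloc_le1 i (a : Th i) t : mean_alloc a t <= 1.
Proof.
rewrite -lee_fin -mean_allocE.
apply: (@le_trans _ _ (\int[Tau]_s (1:R)%:E)%E); last first.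
  by rewrite integral_cst//= probability_setT mule1.
apply: le_integral; [by []|exact: integrable_alloc_mass|exact: finite_measure_integrable_cst|].
by move=> s _; rewrite lee_fin; have /andP[] := alloc_mass_bound a t s.
Qed.

Lemma mean_pay_ge0 i t : 0 <= mean_pay i t.
Proof. by apply: Rintegral_ge0 => s _; exact: pay_ge0. Qed.

Lemma measurable_mean_alloc i (a : Th i) : measurable_fun setT (mean_alloc a).
Proof.
apply/measurable_EFinP.
rewrite (_ : _ \o _ = fun t => \int[Tau]_s (alloc M i t s * s i a)%:E)%E; last first.
  by apply/funext => t; rewrite mean_allocE.
apply: (@measurable_integral_EFin _ _ _ _ _ Tau (fun t s => alloc M i t s * s i a)).
  have [_ _ _ ma _] := M_mechanism; apply: measurable_funM; first exact: ma.
  exact: measurableT_comp (measurable_signal_mass a) measurable_snd.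
by move=> t s; have /andP[] := alloc_mass_bound a t s.
Qed.

Lemma measurable_mean_pay i : measurable_fun setT (mean_pay i).
Proof.
apply/measurable_EFinP.
rewrite (_ : _ \o _ = fun t => \int[Tau]_s (pay M i t s)%:E)%E; last first.
  by apply/funext => t; rewrite mean_payE.
apply: (@measurable_integral_EFin _ _ _ _ _ Tau (fun t s => pay M i t s)).
  by have [_ _ _ _ mp] := M_mechanism; exact: mp.
by move=> t s; exact: pay_ge0.
Qed.

Lemma density_ge0 i (a : Th i) r : 0 <= f i a r.
Proof. by have [_ h0 _] := f_density a. Qed.

Lemma measurable_density i (a : Th i) : measurable_fun setT (f i a).
Proof. by have [h0 _ _] := f_density a. Qed.

Lemma measurable_type_value i (a : Th i) (F : R -> R) : measurable_fun setT F ->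
  measurable_fun setT (fun t : profile T => F (v i a (t i))).
Proof.
move=> mF; apply: (measurableT_proj (F := idfun) (G := fun r : T i => F (v i a r))).
  exact: measurable_id.
by apply: measurableT_comp.
Qed.

Lemma mean_value_ge0 i t :
  0 <= \sum_a mean_alloc a t * v i a (t i).
Proof. exact: le_trans (mean_pay_ge0 i t) (mean_pay_IR i t). Qed.

Lemma measurable_mean_value i :
  measurable_fun setT (fun t => \sum_a mean_alloc a t * v i a (t i)).
Proof.
apply: measurable_sum => a; apply: measurable_funM; first exact: measurable_mean_alloc.
exact: (measurable_type_value a (F := idfun) (@measurable_id _ _ _)).
Qed.

Lemma measurable_mean_markup i :
  measurable_fun setT (fun t => \sum_a mean_alloc a t * markup a (v i a (t i))).
Proof.
apply: measurable_sum => a; apply: measurable_funM; first exact: measurable_mean_alloc.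
apply: (measurable_type_value a (F := markup a)).
apply: measurable_markup => *; [exact: density_ge0|exact: measurable_density].
Qed.

Lemma mean_markup_ge0 i t :
  0 <= \sum_a mean_alloc a t * markup a (v i a (t i)).
Proof.
by apply: sumr_ge0 => a _; rewrite mulr_ge0 ?mean_alloc_ge0 ?markup_ge0//; exact: density_ge0.
Qed.

(** Redraw the type of bidder [i] and apply [information_rent] for each fixed profile of the
    others. *)
Lemma mean_information_rent i :
  (\int[H]_t (mean_pay i t)%:E +
   \int[H]_t (\sum_a mean_alloc a t * markup a (v i a (t i)))%:E <=
   \int[H]_t (\sum_a mean_alloc a t * v i a (t i))%:E)%E.
Proof.
have mP := measurable_mean_pay i.
have mK := measurable_mean_markup i.
have mS := measurable_mean_value i.
have mupd t : measurable_fun setT (fun r : T i => upd_type t r).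
  by apply: measurable_dfwith => //; exact: measurable_cst.
pose F t := mean_pay i t + \sum_a mean_alloc a t * markup a (v i a (t i)).
have F0 t : 0 <= F t by rewrite addr_ge0 ?mean_pay_ge0 ?mean_markup_ge0.
have mF : measurable_fun setT F by exact: measurable_funD.
rewrite -ge0_integralD//; last 4 first.
- by move=> t _; rewrite lee_fin mean_pay_ge0.
- exact/measurable_EFinP.
- by move=> t _; rewrite lee_fin mean_markup_ge0.
- exact/measurable_EFinP.
under eq_integral do rewrite -EFinD.
rewrite (product_law_resample H_indep i (F := fun t => (F t)%:E)); last 2 first.
- exact/measurable_EFinP.
- by move=> t; rewrite lee_fin.
rewrite (product_law_resample H_indep i
  (F := fun t => (\sum_a mean_alloc a t * v i a (t i))%:E)); last 2 first.
- exact/measurable_EFinP.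
- by move=> t; rewrite lee_fin mean_value_ge0.
have mI (G : profile T -> R) : measurable_fun setT G -> (forall t, 0 <= G t) ->
    measurable_fun setT (fun t => \int[h i]_r (G (upd_type t r))%:E)%E.
  move=> mG G0; apply: (@measurable_integral_EFin _ _ _ _ _ (h i) (fun t r => G (upd_type t r))) => //.
  apply: (measurableT_comp (f := G) (g := fun z : profile T * T i => upd_type z.1 z.2)) => //.
  exact: measurable_upd_type.
apply: ge0_le_integral => //.
- by move=> t _; apply: integral_ge0 => r _; rewrite lee_fin.
- exact: (mI F).
- by apply: (mI (fun t => \sum_a mean_alloc a t * v i a (t i))) => // t; exact: mean_value_ge0.
move=> t _.
have fd (a : Th i) := let: And3 _ _ fd := f_density a in fd.
have := information_rent (point : Th i) (measurable_density (i := i)) (density_ge0 (i := i)) fd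
  (f_positive (i := i)) (T_ordered (i := i))
  (y := fun a r => mean_alloc a (upd_type t r)) (p := fun r => mean_pay i (upd_type t r)).
have mc (G : profile T -> R) : measurable_fun setT G ->
    measurable_fun setT (fun r : T i => G (upd_type t r)).
  by move=> mG; exact: (measurableT_comp mG (mupd t)).
move=> rent.
rewrite /F; under eq_integral do rewrite EFinD.
rewrite ge0_integralD//; last 4 first.
- by move=> r _; rewrite lee_fin mean_pay_ge0.
- by apply/measurable_EFinP; exact: mc.
- by move=> r _; rewrite lee_fin mean_markup_ge0.
- by apply/measurable_EFinP; exact: (mc (fun t => \sum_a mean_alloc a t * markup a (v i a (t i)))).
under [X in (_ + X <= _)%E]eq_integral do rewrite upd_type_in.
under [leRHS]eq_integral do rewrite upd_type_in.
apply: rent => //.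
- by move=> a; apply: mc; exact: measurable_mean_alloc.
- exact: mc.
- by move=> a r; exact: mean_alloc_ge0.
- by move=> r; exact: mean_pay_ge0.
- by move=> r; have := mean_pay_IR i (upd_type t r); rewrite upd_type_in.
move=> r r'; have := mean_pay_IC (upd_type t r') r; rewrite upd_type_in.
rewrite (_ : upd_type (upd_type t r') r = upd_type t r)//.
apply: functional_extensionality_dep => j.
have [<-|ij] := eqVneq i j; first by rewrite !upd_type_in.
by rewrite !upd_type_out// eq_sym.
Qed.

Local Notation W := (@regulated_belief R n Th).
Local Notation SMA := (simulated_myerson v f (@regulated_belief R n Th)).
Notation x b th i := (base_alloc v f b th i).
Notation p b th i := (base_pay v f b th i).

Definition mean_belief (th : states) : R := \int[Tau]_s W s th.

Lemma integrable_belief th : Tau.-integrable setT (fun s => (W s th)%:E).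
Proof.
apply: (@bounded_integrable _ _ _ _ _ 1).
  by apply/measurable_EFinP; exact: measurable_regulated_belief.
by move=> s; rewrite /= lee_fin ger0_norm ?regulated_belief_ge0 ?regulated_belief_le1.
Qed.

Lemma mean_beliefE th : (\int[Tau]_s (W s th)%:E = (mean_belief th)%:E)%E.
Proof. by rewrite fineK// integrable_fin_num//; exact: integrable_belief. Qed.

Lemma mean_belief_ge0 th : 0 <= mean_belief th.
Proof. by apply: Rintegral_ge0 => s _; exact: regulated_belief_ge0. Qed.

Lemma mean_belief_comb (k : states -> R) :
  (\int[Tau]_s (\sum_th W s th * k th)%:E = (\sum_th mean_belief th * k th)%R%:E)%E.
Proof.
have kW th : Tau.-integrable setT (fun s => (W s th * k th)%:E).
  under eq_fun do rewrite mulrC EFinM.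
  exact/integrableZl/integrable_belief.
under eq_integral do rewrite -sumEFin.
rewrite integral_sum// -sumEFin; apply: eq_bigr => th _.
under eq_integral do rewrite mulrC EFinM.
rewrite integralZl//; last exact: integrable_belief.
by rewrite mean_beliefE -EFinM mulrC.
Qed.

(** For each signal profile, the mean virtual value of a bidder under [s i] is also his mean under
    the product belief, whose marginals are the [s i]. All bidders are thus averaged over one
    belief, and Myerson's allocation is optimal state by state. *)
Lemma virtual_surplus_le t :
  \sum_i \sum_a mean_alloc a t * phi v f a (t i) <=
  \sum_th mean_belief th * \sum_i x t th i * phi v f (th i) (t i).
Proof.
rewrite -lee_fin -mean_belief_comb -sumEFin.
under eq_bigr do rewrite -mean_alloc_comb.
rewrite -integral_sum//; last by move=> i; exact: integrable_alloc_mean.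
apply: le_integral => //.
- by apply: integrable_sum => // i _; exact: integrable_alloc_mean.
- under eq_fun do rewrite -sumEFin.
  apply: integrable_sum => // th _; under eq_fun do rewrite mulrC EFinM.
  exact/integrableZl/integrable_belief.
move=> s _; rewrite sumEFin lee_fin.
under eq_bigr do rewrite -regulated_belief_marginal mulr_sumr.
rewrite exchange_big/=; apply: ler_sum => th _.
under eq_bigr do rewrite mulrCA.
rewrite -mulr_sumr ler_wpM2l ?regulated_belief_ge0//.
apply: base_alloc_optimal => [i|]; first exact: alloc_ge0.
by have [_ _ h1 _ _] := M_mechanism; exact: h1.
Qed.

Lemma integral_type_value_lty i (a : Th i) :
  (\int[H]_t (`|v i a (t i)|)%:E < +oo)%E.
Proof.
rewrite (product_law_resample H_indep i (F := fun t => (`|v i a (t i)|)%:E)); last 2 first.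
- by apply/measurable_EFinP; apply: (measurable_type_value a (F := Num.norm)).
- by move=> t; rewrite lee_fin.
under eq_integral => t _ do under eq_integral do rewrite upd_type_in.
rewrite integral_cst//= probability_setT mule1.
by have /integrableP[_] := v_finite_mean a.
Qed.

Lemma revenue_le : (revenue Tau H M <= revenue Tau H SMA)%E.
Proof.
have mfd i (a : Th i) : measurable_fun setT (f i a) by exact: measurable_density.
have fd0 i (a : Th i) r : 0 <= f i a r by exact: density_ge0.
(* Initial [S] stands for the simulated auction, [M] for the competitor; [P], [V] and [K] are
   payment, value and markup, averaged over the signals. *)
pose SP t := \sum_(k : 'I_n * states) mean_belief k.2 * p t k.2 k.1.
pose SV t := \sum_(k : 'I_n * states) mean_belief k.2 * (x t k.2 k.1 * v k.1 (k.2 k.1) (t k.1)).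
pose SK t := \sum_(k : 'I_n * states) mean_belief k.2 * (x t k.2 k.1 * markup (k.2 k.1) (v k.1 (k.2 k.1) (t k.1))).
pose MP t := \sum_i mean_pay i t.
pose MV t := \sum_i \sum_a mean_alloc a t * v i a (t i).
pose MK t := \sum_i \sum_a mean_alloc a t * markup a (v i a (t i)).
have xv0 t (k : 'I_n * states) : 0 <= x t k.2 k.1 * v k.1 (k.2 k.1) (t k.1).
  exact: base_alloc_value_ge0.
have xk0 t (k : 'I_n * states) : 0 <= x t k.2 k.1 * markup (k.2 k.1) (v k.1 (k.2 k.1) (t k.1)).
  by rewrite mulr_ge0 ?base_alloc_ge0// markup_ge0.
have xp0 t (k : 'I_n * states) : 0 <= p t k.2 k.1 by exact: base_pay_ge0.
have mp (k : 'I_n * states) : measurable_fun setT (fun t => p t k.2 k.1).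
  exact: measurable_base_pay.
have mxv (k : 'I_n * states) : measurable_fun setT
    (fun t => x t k.2 k.1 * v k.1 (k.2 k.1) (t k.1)).
  apply: measurable_funM; first exact: measurable_base_alloc.
  exact: (measurable_type_value _ (F := idfun) (@measurable_id _ _ _)).
have mxk (k : 'I_n * states) : measurable_fun setT
    (fun t => x t k.2 k.1 * markup (k.2 k.1) (v k.1 (k.2 k.1) (t k.1))).
  apply: measurable_funM; first exact: measurable_base_alloc.
  apply: (measurable_type_value _ (F := markup (k.2 k.1))).
  exact: measurable_markup.
have scaled (G : 'I_n * states -> profile T -> R) :
    (forall k, measurable_fun setT (G k)) -> (forall k t, 0 <= G k t) ->
    (\int[H]_t (\sum_(k : 'I_n * states) mean_belief k.2 * G k t)%:E =
     \sum_(k : 'I_n * states) (mean_belief k.2)%:E * \int[H]_t (G k t)%:E)%E.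
  move=> mG G0; rewrite ge0_integral_sum_EFin; last 2 first.
  - by move=> k; exact: measurable_funM.
  - by move=> k t; rewrite mulr_ge0 ?mean_belief_ge0.
  apply: eq_bigr => k _; under eq_integral do rewrite EFinM.
  rewrite ge0_integralZl_EFin ?mean_belief_ge0//; last exact/measurable_EFinP.
  by move=> t _; rewrite lee_fin.
have revSMA : revenue Tau H SMA = (\int[H]_t (SP t)%:E)%E.
  have [_ pay0 _ _ mpay] := SMA_is_mechanism v mfd fd0.
  rewrite /revenue (exchange_integral_EFin Tau H (F := fun s t => \sum_i pay SMA i t s)); last 2 first.
  - apply: measurable_sum => i.
    exact: (measurableT_comp (mpay i) (@measurable_swap _ _ _ _)).
  - by move=> s t; apply: sumr_ge0 => i _; exact: pay0.
  apply: eq_integral => t _.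
  under eq_integral => s _ do
    (rewrite exchange_big/=; under eq_bigr => th _ do rewrite -mulr_sumr).
  rewrite mean_belief_comb; congr (_%:E).
  under eq_bigr do rewrite mulr_sumr.
  by rewrite exchange_big pair_big.
have revM : revenue Tau H M = (\int[H]_t (MP t)%:E)%E.
  have [_ pay0 _ _ mpay] := M_mechanism.
  rewrite /revenue (exchange_integral_EFin Tau H (F := fun s t => \sum_i pay M i t s)); last 2 first.
  - apply: measurable_sum => i.
    exact: (measurableT_comp (mpay i) (@measurable_swap _ _ _ _)).
  - by move=> s t; apply: sumr_ge0 => i _; exact: pay0.
  apply: eq_integral => t _.
  rewrite ge0_integral_sum_EFin; last 2 first.
  - by move=> i; exact: measurable_pay.
  - by move=> i s; exact: pay0.
  by rewrite -sumEFin; apply: eq_bigr => i _; exact: mean_payE.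
have mMP : measurable_fun setT MP by apply: measurable_sum => i; exact: measurable_mean_pay.
have mMV : measurable_fun setT MV by apply: measurable_sum => i; exact: measurable_mean_value.
have mMK : measurable_fun setT MK by apply: measurable_sum => i; exact: measurable_mean_markup.
have mSV : measurable_fun setT SV by apply: measurable_sum => k; exact: measurable_funM.
have mSK : measurable_fun setT SK by apply: measurable_sum => k; exact: measurable_funM.
have MV_ge0 t : 0 <= MV t by apply: sumr_ge0 => i _; exact: mean_value_ge0.
have MK_ge0 t : 0 <= MK t by apply: sumr_ge0 => i _; exact: mean_markup_ge0.
have SV_ge0 t : 0 <= SV t by apply: sumr_ge0 => k _; rewrite mulr_ge0 ?mean_belief_ge0.
have SK_ge0 t : 0 <= SK t by apply: sumr_ge0 => k _; rewrite mulr_ge0 ?mean_belief_ge0.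
have rent : (\int[H]_t (MP t)%:E + \int[H]_t (MK t)%:E <= \int[H]_t (MV t)%:E)%E.
  rewrite /MP /MK /MV !ge0_integral_sum_EFin.
  - by rewrite -big_split/=; apply: lee_sum => i _; exact: mean_information_rent.
  - exact: measurable_mean_value.
  - by move=> i t; exact: mean_value_ge0.
  - exact: measurable_mean_markup.
  - by move=> i t; exact: mean_markup_ge0.
  - exact: measurable_mean_pay.
  - by move=> i t; exact: mean_pay_ge0.
have surplus : (\int[H]_t (MV t)%:E + \int[H]_t (SK t)%:E <=
    \int[H]_t (MK t)%:E + \int[H]_t (SV t)%:E)%E.
  rewrite -!ge0_integralD_EFin//.
  apply: ge0_le_integral_EFin.
  - exact: measurable_funD.
  - exact: measurable_funD.
  - by move=> t; rewrite addr_ge0.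
  move=> t; rewrite -lerBlDl -addrA [SK t - _]addrC addrA -lerBrDr.
  have := virtual_surplus_le t.
  rewrite (_ : \sum_i _ = MV t - MK t); last first.
    rewrite -sumrB; apply: eq_bigr => i _; rewrite -sumrB; apply: eq_bigr => a _.
    by rewrite phi_markup mulrBr.
  rewrite (_ : \sum_th _ = SV t - SK t)//.
  rewrite -sumrB; under eq_bigr do rewrite mulr_sumr.
  rewrite exchange_big pair_big/=; apply: eq_bigr => -[i th] _ /=.
  by rewrite phi_markup -!mulrBr.
(* Proved for each bidder and state profile separately: redrawing the own type reduces it to
   [base_payment]. *)
have payment : (\int[H]_t (SV t)%:E <= \int[H]_t (SP t)%:E + \int[H]_t (SK t)%:E)%E.
  rewrite (scaled _ mxv) ?(scaled _ mp) ?(scaled _ mxk)//.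
  rewrite -big_split/=; apply: lee_sum => k _.
  rewrite -ge0_muleDr//; last 2 first.
  - by apply: integral_ge0 => t _; rewrite lee_fin.
  - by apply: integral_ge0 => t _; rewrite lee_fin.
  rewrite lee_wpmul2l ?lee_fin ?mean_belief_ge0//.
  rewrite -ge0_integralD//; last 4 first.
  - by move=> t _; rewrite lee_fin.
  - exact/measurable_EFinP.
  - by move=> t _; rewrite lee_fin.
  - exact/measurable_EFinP.
  under [leRHS]eq_integral do rewrite -EFinD.
  have mD : measurable_fun setT (fun t => p t k.2 k.1 +
      x t k.2 k.1 * markup (k.2 k.1) (v k.1 (k.2 k.1) (t k.1))).
    exact: measurable_funD.
  rewrite (product_law_resample H_indep k.1
    (F := fun t => (x t k.2 k.1 * v k.1 (k.2 k.1) (t k.1))%:E)); last 2 first.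
  - exact/measurable_EFinP.
  - by move=> t; rewrite lee_fin.
  rewrite (product_law_resample H_indep k.1 (F := fun t => (p t k.2 k.1 +
      x t k.2 k.1 * markup (k.2 k.1) (v k.1 (k.2 k.1) (t k.1)))%:E)); last 2 first.
  - exact/measurable_EFinP.
  - by move=> t; rewrite lee_fin addr_ge0.
  have mI (G : profile T -> R) : measurable_fun setT G -> (forall t, 0 <= G t) ->
      measurable_fun setT (fun t => \int[h k.1]_r (G (upd_type t r))%:E)%E.
    move=> mG G0; apply: (@measurable_integral_EFin _ _ _ _ _ (h k.1) (fun t r => G (upd_type t r))) => //.
    apply: (measurableT_comp (f := G) (g := fun z : profile T * T k.1 => upd_type z.1 z.2)) => //.
    exact: measurable_upd_type.
  apply: ge0_le_integral => //.
  - by move=> t _; apply: integral_ge0 => r _; rewrite lee_fin.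
  - by apply: (mI (fun t => x t k.2 k.1 * v k.1 (k.2 k.1) (t k.1))).
  - by apply: (mI (fun t => p t k.2 k.1 +
      x t k.2 k.1 * markup (k.2 k.1) (v k.1 (k.2 k.1) (t k.1)))) => // t; rewrite addr_ge0.
  move=> t _.
  have mc (G : profile T -> R) : measurable_fun setT G ->
      measurable_fun setT (fun r : T k.1 => G (upd_type t r)).
    move=> mG; apply: (measurableT_comp (f := G)) => //.
    by apply: measurable_dfwith => //; exact: measurable_cst.
  under [leRHS]eq_integral do rewrite EFinD.
  rewrite ge0_integralD//; last 4 first.
  - by move=> r _; rewrite lee_fin.
  - by apply/measurable_EFinP; exact: (mc (fun t => p t k.2 k.1)).
  - by move=> r _; rewrite lee_fin.
  - by apply/measurable_EFinP; exact: (mc (fun t => x t k.2 k.1 * markup (k.2 k.1) (v k.1 (k.2 k.1) (t k.1)))).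
  under [leLHS]eq_integral do rewrite upd_type_in.
  under [X in (_ <= _ + X)%E]eq_integral do rewrite upd_type_in.
  exact: base_payment.
have mabs i (a : Th i) : measurable_fun setT (fun t : profile T => `|v i a (t i)|).
  exact: (measurable_type_value a (F := Num.norm)).
(* Finite mean values bound [MV] and [SV]; [rent] and [surplus] then make both markup integrals
   finite, so that they can be cancelled. *)
have MV_fin : (\int[H]_t (MV t)%:E < +oo)%E.
  apply: (@le_lt_trans _ _ (\int[H]_t (\sum_i \sum_a `|v i a (t i)|)%:E)%E).
    apply: ge0_le_integral_EFin => //.
      by apply: measurable_sum => i; exact: measurable_sum.
    move=> t; apply: ler_sum => i _; apply: ler_sum => a _.
    apply: le_trans (ler_norm _) _; rewrite normrM ger0_norm ?mean_alloc_ge0//.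
    by rewrite ler_piMl// mean_alloc_le1.
  rewrite ge0_integral_sum_EFin; last 2 first.
  - by move=> i; exact: measurable_sum.
  - by move=> i t; exact: sumr_ge0.
  apply: lte_sum_pinfty => i _; rewrite ge0_integral_sum_EFin//.
  by apply: lte_sum_pinfty => a _; exact: integral_type_value_lty.
have SV_fin : (\int[H]_t (SV t)%:E < +oo)%E.
  rewrite (scaled _ mxv)//; apply: lte_sum_pinfty => k _.
  apply: lte_mul_pinfty; rewrite ?lee_fin ?mean_belief_ge0//.
  apply: le_lt_trans (integral_type_value_lty (k.2 k.1)).
  apply: ge0_le_integral_EFin => // t.
  apply: le_trans (ler_norm _) _; rewrite normrM ger0_norm ?base_alloc_ge0//.
  by rewrite ler_piMl// /base_alloc /myerson_alloc lern1 leq_b1.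
have ge0I (G : profile T -> R) : (forall t, 0 <= G t) -> (0 <= \int[H]_t (G t)%:E)%E.
  by move=> G0; apply: integral_ge0 => t _; rewrite lee_fin.
have MK0 : (0 <= \int[H]_t (MK t)%:E)%E.
  by apply: ge0I => t; apply: sumr_ge0 => i _; exact: mean_markup_ge0.
have MP0 : (0 <= \int[H]_t (MP t)%:E)%E.
  by apply: ge0I => t; apply: sumr_ge0 => i _; exact: mean_pay_ge0.
have SK0 : (0 <= \int[H]_t (SK t)%:E)%E.
  by apply: ge0I => t; apply: sumr_ge0 => k _; rewrite mulr_ge0 ?mean_belief_ge0.
have MV0 : (0 <= \int[H]_t (MV t)%:E)%E.
  by apply: ge0I => t; apply: sumr_ge0 => i _; exact: mean_value_ge0.
have MK_fin : (\int[H]_t (MK t)%:E)%E \is a fin_num.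
  rewrite ge0_fin_numE//; apply: le_lt_trans MV_fin; apply: le_trans rent.
  by rewrite leeDr.
have SK_fin : (\int[H]_t (SK t)%:E)%E \is a fin_num.
  rewrite ge0_fin_numE//; apply: (@le_lt_trans _ _ (\int[H]_t (MK t)%:E + \int[H]_t (SV t)%:E)%E).
    by apply: le_trans surplus; rewrite leeDr.
  by rewrite lte_add_pinfty// -ge0_fin_numE.
(* With K the markup v - phi, y the mean allocation of M and x that of the
   auction: E[pay_M] + E[y K] <= E[y v] is [rent], E[y v] + E[x K] <=
   E[y K] + E[x v] is [surplus] and E[x v] <= E[pay] + E[x K] is [payment]. *)
rewrite revM revSMA.
have MSK_fin : (\int[H]_t (MK t)%:E + \int[H]_t (SK t)%:E)%E \is a fin_num.
  by rewrite fin_numD MK_fin.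
rewrite -(@leeD2rE _ (\int[H]_t (MK t)%:E + \int[H]_t (SK t)%:E)%E)//.
rewrite addeA; apply: (@le_trans _ _ (\int[H]_t (MV t)%:E + \int[H]_t (SK t)%:E)%E).
  exact: leeD2r.
apply: le_trans surplus _; rewrite [leRHS]addeCA.
by apply: leeD2l.
Qed.

End Revenue.

(** * Unregulated posterior and own-signal values *)

Section Posterior.
Context {R : realType} {n : nat} {d : measure_display}.
Context {T : 'I_n -> measurableType d} {h : forall i, probability (T i) R}.
Context {Th : 'I_n -> finPointedType}.
Variable v : forall i, Th i -> {RV (h i) >-> R}.
Local Notation S := (@signal R n Th).
Local Notation states := {dffun forall i, Th i}.
Variables (g : dist R states) (Tau : probability (profile S) R).

Lemma marginal_ge0 i (a : Th i) : 0 <= marginal g a.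
Proof. by apply: sumr_ge0 => th _; exact: mass_ge0. Qed.

Lemma likelihood_ge0 (s : profile S) th : 0 <= likelihood g s th.
Proof.
rewrite mulr_ge0 ?mass_ge0//; apply: prodr_ge0 => i _.
by rewrite divr_ge0 ?mass_ge0 ?marginal_ge0.
Qed.

Lemma measurable_posterior th : measurable_fun setT (fun s : profile S => posterior g s th).
Proof.
have ml th' : measurable_fun setT (fun s : profile S => likelihood g s th').
  apply: measurable_funM => //; apply: measurable_prod => i _.
  by apply: measurable_funM => //; exact: measurable_signal_mass.
apply: measurable_funM => //; apply: measurable_fun_ge0_inv.
  exact: measurable_sum.
by move=> s; apply: sumr_ge0 => th' _; exact: likelihood_ge0.
Qed.

Lemma measurable_interim_value i (t : T i) :
  measurable_fun setT (interim_value v (posterior g) t).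
Proof.
apply: measurable_sum => th; apply: measurable_funM => //.
exact: measurable_posterior.
Qed.

(** Group the state profiles by their coordinate [i]: the posterior weight of each group is almost
    surely the own belief. *)
Lemma interim_value_own : own_signal_sufficient g Tau ->
  {ae Tau, forall s i (t : T i), interim_value v (posterior g) t s = own_value v t s}.
Proof.
apply: filterS => s Hs i t; rewrite /interim_value /own_value /mean.
rewrite (partition_big (fun th : states => th i) predT)//=.
apply: eq_bigr => a _; rewrite -Hs mulr_suml; apply: eq_bigr => th /eqP ->.
by [].
Qed.

End Posterior.

Theorem corollary7p5
  (R : realType) (n : nat) (d : measure_display)
  (T : 'I_n -> measurableType d) (h : forall i, probability (T i) R)
  (Th : 'I_n -> finPointedType)
  (v : forall i, Th i -> {RV (h i) >-> R})
  (f : forall i, Th i -> R -> R)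
  (H : probability (profile T) R)
  (g : dist R {dffun forall i, Th i})
  (tau : forall i, probability (signal Th i) R)
  (Tau : probability (profile (signal Th)) R)
  (H_indep : product_law h H)
  (f_density : value_density v f)
  (v_finite_mean : finite_mean_values v)
  (f_positive : positive_density v f)
  (T_ordered : ordered_types v)
  (tau_experiment : forall i, is_experiment g (tau i))
  (Tau_law : joint_law g tau Tau)
  (own_signal : own_signal_sufficient g Tau)
  (info_sufficient : information_sufficiency v f tau)
  (v_regular : regular_values v)
  (phi_regular : regular_virtual_values v f) :
  let SMA := simulated_myerson v f (@regulated_belief R n Th) in
  [/\ is_mechanism SMA,
      regulated_dominant_strategy_IIC v g tau SMA,
      ex_post_IR tau (own_value v) SMA,
      max_revenue_for g tau Tau H (interim_value v (posterior g)) SMA &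
      max_revenue_for g tau Tau H (own_value v) SMA].
Proof.
have mf i (a : Th i) : measurable_fun setT (f i a) by have [] := f_density i a.
have f0 i (a : Th i) r : 0 <= f i a r by have [] := f_density i a.
split.
- exact: SMA_is_mechanism.
- exact: SMA_dominant_strategy.
- exact: SMA_ex_post_IR.
(* Competitors judged by unregulated interim values: these agree almost surely with own-signal
   values, so the same revenue bound applies. *)
- move=> M M_mech M_IIC M_IR.
  apply: (revenue_le H_indep f_density v_finite_mean f_positive T_ordered
    Tau_law phi_regular _ (interim_value_own v own_signal) M_mech M_IIC M_IR).
  exact: measurable_interim_value.
- move=> M M_mech M_IIC M_IR.
  apply: (revenue_le H_indep f_density v_finite_mean f_positive T_ordered
    Tau_law phi_regular _ _ M_mech M_IIC M_IR).
    exact: measurable_own_value.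
  exact: nearW.
Qed.
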